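(* Let $\beta\ge 1$ be an integer. Then $K_{(3,2^{\beta})}$ is Schur-positive. Moreover: (1) For all integers $C,D\ge 0$ such that $2C+D=2\beta$, \[ [s_{(3,2^C,1^D)}]X_{K_{(3,2^{\beta})}}=[s_{(2^C,1^D)}]X_{K_{(2^{\beta})}}=\frac{\beta!}{(\beta-C)!}\cdot N_{\mathrm{sp}}(K_{(2^{\beta-C})}). \] (2) For all integers $C\ge 1$, $D\ge 1$ such that $2C+D=2\beta+3$, \[ [s_{(2^C,1^D)}]X_{K_{(3,2^{\beta})}}=\frac{\beta!}{(\beta-C+1)!}\Big((\beta-C+1)\cdot N_{\mathrm{sp}}(K_{(3,2^{\beta-C})})-N_{\mathrm{sp}}(K_{(2^{\beta-C+1})})+(C+2)\cdot N_{\mathrm{sp}}(K_{(2^{\beta-C+1},1)})\Big), \] where $N_{\mathrm{sp}}(K_{(3,2^{\beta-C})})$ is set equal to $0$ if $\beta<C$. (3) \[ [s_{(1^{2\beta+3})}]X_{K_{(3,2^{\beta})}}=N_{\mathrm{sp}}(K_{(3,2^{\beta})}). \]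
   Context: A partition is a weakly decreasing finite sequence of positive integers; exponents denote repetition, e.g. $(3,2^C,1^D)$ is a $3$ followed by $C$ twos and $D$ ones. For a partition $\lambda=(\lambda_1,\ldots,\lambda_k)$, the complete multipartite graph $K_\lambda$ is the graph whose vertex set is a disjoint union of $k$ stable (pairwise non-adjacent) sets of sizes $\lambda_1,\ldots,\lambda_k$ with every possible edge between different sets included. It is viewed as the incomparability graph of the poset which is the disjoint union of chains with $\lambda_1,\ldots,\lambda_k$ elements (elements of different chains are incomparable): vertices are the poset elements, and two vertices are adjacent if and only if they are incomparable. The partial order $\le$ on the vertices of $K_\lambda$ is that of this poset. For the empty partition, $K_\lambda$ is the graph with no vertices. For $G$ the incomparability graph of a finite poset $(P,\le)$, a non-increasing sequence in $G$ is a sequence $(v_1,\ldots,v_m)$ of vertices of $G$ with $v_i\nleq v_{i+1}$ for $1\le i\le m-1$. A spanning non-increasing sequence of $G$ is a non-increasing sequence including every vertex of $G$ exactly once. $N_{\mathrm{sp}}(G)$ denotes the number of spanning non-increasing sequences of $G$; if $G$ has no vertices, $N_{\mathrm{sp}}(G)=1$. For a finite graph $G$ with vertices $v_1,\ldots,v_n$, the chromatic symmetric function is $X_G=X_G(\mathbf{x})=\sum_{\mathcal{C}}x_{\mathcal{C}(v_1)}\cdots x_{\mathcal{C}(v_n)}$, summed over all proper colorings $\mathcal{C}:V(G)\to\{1,2,3,\ldots\}$. $[s_\mu]X_G$ denotes the coefficient of the Schur function $s_\mu$ in the expansion of $X_G$ in the Schur basis. $G$ is Schur-positive if $[s_\mu]X_G\ge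 0$ for all partitions $\mu$. *)

(* Defs.v *)
From Stdlib Require Import ClassicalEpsilon.
From HB Require Import structures.
From mathcomp Require Import all_boot all_order all_algebra.
From mathcomp Require Import finmap mpoly.

Set Implicit Arguments.
Unset Strict Implicit.
Unset Printing Implicit Defensive.

Import GRing.Theory Num.Theory.
Local Open Scope ring_scope.

Definition is_part (la : seq nat) : bool :=
  sorted geq la && all (fun k => 0 < k)%N la.

(* Pairs (i, j) with j < la_i.  These serve both as the elements of the disjoint
   union of chains of sizes la_0, la_1, ... (j-th element of the i-th chain) and
   as the cells (row i, column j) of the Young diagram of la. *)
Definition cell (la : seq nat) : finType :=
  {i : 'I_(size la) & 'I_(nth 0%N la i)}.

Definition cell_row (la : seq nat) (x : cell la) : nat := tag x.
Definition cell_col (la : seq nat) (x : cell la) : nat := tagged x.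

Definition chains_le (la : seq nat) : rel (cell la) :=
  fun x y => (cell_row x == cell_row y) && (cell_col x <= cell_col y)%N.

Definition K_adj (la : seq nat) : rel (cell la) :=
  fun x y => cell_row x != cell_row y.

Definition incomparable (T : finType) (le : rel T) : rel T :=
  fun x y => ~~ le x y && ~~ le y x.

Lemma cell_inj (la : seq nat) (x y : cell la) :
  cell_row x = cell_row y -> cell_col x = cell_col y -> x = y.
Proof.
case: x y => [i a] [j b]; rewrite /cell_row /cell_col /= => /val_inj ij.
by subst j => /val_inj ->.
Qed.

Lemma chains_le_refl (la : seq nat) : reflexive (@chains_le la).
Proof. by move=> x; rewrite /chains_le eqxx leqnn. Qed.

Lemma chains_le_anti (la : seq nat) : antisymmetric (@chains_le la).
Proof.
move=> x y /andP[/andP[/eqP rxy cxy] /andP[_ cyx]].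
by apply: cell_inj => //; apply/eqP; rewrite eqn_leq cxy.
Qed.

Lemma chains_le_trans (la : seq nat) : transitive (@chains_le la).
Proof.
move=> y x z /andP[/eqP rxy cxy] /andP[ryz cyz].
by rewrite /chains_le rxy ryz (leq_trans cxy cyz).
Qed.

Lemma K_adj_incomparable (la : seq nat) :
  @K_adj la =2 incomparable (@chains_le la).
Proof.
move=> x y; rewrite /incomparable /chains_le /K_adj (eq_sym (cell_row y)).
by case: eqP => //= _; rewrite -negb_or leq_total.
Qed.

Definition nonincreasing (T : finType) (le : rel T) (s : seq T) : bool :=
  sorted (fun x y => ~~ le x y) s.

Definition Nsp (T : finType) (le : rel T) : nat :=
  #|[set s : #|T|.-tuple T | nonincreasing le s && [forall x, count_mem x s == 1%N]]|.

Definition NspK (la : seq nat) : nat := Nsp (@chains_le la).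

(* A power series in x_0, x_1, ... of bounded degree is given by its truncations
   f N = f(x_0, ..., x_(N-1), 0, 0, ...), one for every N; an identity between
   such series holds iff it holds for all truncations. *)
Definition truncations := forall N : nat, {mpoly int[N]}.

Definition proper_coloring (T : finType) (e : rel T) (N : nat)
    (C : {ffun T -> 'I_N}) : bool :=
  [forall u, forall v, e u v ==> (C u != C v)].

Definition chromatic_symfun (T : finType) (e : rel T) : truncations := fun N =>
  \sum_(C : {ffun T -> 'I_N} | proper_coloring e C) \prod_(v : T) 'X_(C v).

Definition semistandard (mu : seq nat) (N : nat)
    (t : {ffun cell mu -> 'I_N}) : bool :=
  [forall x, forall y,
    ((cell_row x == cell_row y) && (cell_col x <= cell_col y)%N
       ==> (t x <= t y)%N) &&
    ((cell_col x == cell_col y) && (cell_row x < cell_row y)%N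
       ==> (t x < t y)%N)].

Definition schur (mu : seq nat) : truncations := fun N =>
  \sum_(t : {ffun cell mu -> 'I_N} | semistandard t) \prod_(x : cell mu) 'X_(t x).

Definition schur_expansion (f : truncations)
    (c : {fsfun seq nat -> int with 0}) : Prop :=
  (forall mu, mu \in finsupp c -> is_part mu) /\
  (forall N, f N = \sum_(mu <- finsupp c) c mu *: schur mu N).

(* Every symmetric function has exactly one Schur expansion, so the choice made
   by epsilon is forced for such f; for other f the value is irrelevant. *)
Definition schur_coef (f : truncations) (mu : seq nat) : int :=
  epsilon (inhabits [fsfun]) (schur_expansion f) mu.

Definition schur_positive (f : truncations) : Prop :=
  forall mu, is_part mu -> 0 <= schur_coef f mu.

Definition XK (la : seq nat) : truncations := chromatic_symfun (@K_adj la).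

(* Main.v *)
(* Write D(m, n) for the m-th finite difference of k -> k! at n.  Deletion-contraction
   on the pairs (u, w) that may not be consecutive gives Nsp(2^m) = D(m, m),
   Nsp(2^m, 1) = D(m, m+1) and Nsp(3, 2^m) = D(m+1, m+2) - D(m, m+2) - D(m+1, m+1).

   For K_(2^a, 1^b), looking at the vertices that receive a new color x gives
     X(a, b) + x (2a X(a-1, b+1) + b X(a, b-1)) + x^2 a X(a-1, b),
   and the Schur functions of the shapes (2^C, 1^D) obey a branching rule of the same
   form, so the Schur expansion of X(a, b) follows by induction on the number of
   variables, with coefficients a!/(a-C)! D(a-C, a-C+b).

   Finally (a+1) X_(3, 2^a) = p_1 X(a+1, 0) + a X(a+1, 1): add an isolated vertex z to
   K_(2^(a+1)); a coloring for which the color of z is new extends in the same way for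
   each of the a+1 parts, and otherwise exactly one part contains the color of z.  The
   Pieri rule for p_1 s_(2^C, 1^D) then gives the expansion of X_(3, 2^a), in which the
   coefficient of s_(2^C, 1^D) with C > 0 is beta!/(beta-C+1)! (beta+2) Nsp(2^(beta-C+1), 1). *)

From Stdlib Require Import ClassicalEpsilon.
Require Import Defs.
From mathcomp Require Import all_boot all_order all_algebra.
From mathcomp Require Import finmap mpoly ring zify.

Set Implicit Arguments.
Unset Strict Implicit.
Unset Printing Implicit Defensive.

Import GRing.Theory Num.Theory.
Local Open Scope ring_scope.

(** * Differences of factorials *)

(** For n >= m this counts the orderings of n + m items in which none of m disjoint ordered pairs
    occurs consecutively; see [navoid_pairs]. *)
Fixpoint fdiff (m n : nat) : int :=
  if m is m'.+1 then fdiff m' n.+1 - fdiff m' n else (n`!)%:R.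

Lemma fdiffS m n : fdiff m.+1 n = fdiff m n.+1 - fdiff m n.
Proof. by []. Qed.

(** Leibniz rule for the m-th difference of (k+1) k!, whose first factor is linear in k. At m = 0
    the default in [m.-1] is harmless, as its factor is 0. *)
Lemma fdiffSr m n :
  fdiff m n.+1 = (n.+1 + m)%:R * fdiff m n + m%:R * fdiff m.-1 n.
Proof.
elim: m n => [|m IHm] n; first by rewrite /= factS natrM addn0 mul0r addr0.
rewrite /= (IHm n.+1); case: m IHm => [|m] IHm.
  by move: (IHm n); rewrite /= !mul0r => ->; ring.
by rewrite [in m.+1%:R * _]/= (IHm n) /=; ring.
Qed.

(** By [fdiffSr], [fdiff m.+2 n] is a combination of [fdiff m.+1 n] and [fdiff m n] with nonnegative
    coefficients, so the induction carries two consecutive orders. *)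
Lemma fdiff_ge0 m n : 0 <= fdiff m n.
Proof.
suff /andP[] : (0 <= fdiff m n) && (0 <= fdiff m.+1 n) by [].
elim: m n => [|m IHm] n.
  have f_ge0 : 0 <= fdiff 0 n by rewrite /= ler0n.
  rewrite f_ge0 andTb fdiffS fdiffSr [0.-1]/=.
  suff -> : (n.+1 + 0)%:R * fdiff 0 n + 0%:R * fdiff 0 n - fdiff 0 n
              = n%:R * fdiff 0 n by rewrite mulr_ge0.
  by ring.
case/andP: (IHm n) => f_ge0 f1_ge0; rewrite f1_ge0 fdiffS fdiffSr [m.+1.-1]/=.
suff -> : (n.+1 + m.+1)%:R * fdiff m.+1 n + m.+1%:R * fdiff m n - fdiff m.+1 n
            = (n + m.+1)%:R * fdiff m.+1 n + m.+1%:R * fdiff m n.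
  by rewrite addr_ge0 ?mulr_ge0.
by rewrite addSn -[in LHS]addn1 natrD; ring.
Qed.

Definition Nsp3 (m : nat) : int :=
  fdiff m.+1 m.+2 - fdiff m m.+2 - fdiff m.+1 m.+1.

(** Two uses of [fdiffSr] eliminate [fdiff m.-1 m]. This settles the case b = 0 of the coefficient
    recurrence [twos_coefD]. *)
Lemma fdiff_diag m : fdiff m.+1 m.+1 = m.+1%:R * (2%:R * fdiff m m.+1 - fdiff m m).
Proof.
rewrite fdiffS fdiffSr.
have -> : m%:R * fdiff m.-1 m.+1 = m%:R * (fdiff m.-1 m + fdiff m m).
  by case: m => [|m]; rewrite ?mul0r // [in RHS]fdiffS; congr (_ * _); ring.
have := fdiffSr m m; set p := _ * fdiff _.-1 _ => e.
have -> : m%:R * (fdiff m.-1 m + fdiff m m) = p + m%:R * fdiff m m.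
  by rewrite /p; ring.
have -> : p = fdiff m m.+1 - (m.+1 + m)%:R * fdiff m m by rewrite e; ring.
by ring.
Qed.

(** The right-hand side is what the identity for (m+1) X_(3, 2^m) produces at the one-column
    shape. *)
Lemma Nsp3E m :
  m.+1%:R * Nsp3 m = fdiff m.+1 m.+1 + m%:R * fdiff m.+1 m.+2.
Proof.
rewrite /Nsp3 (fdiffSr m.+1 m.+1) [m.+1.-1]/=.
have -> : fdiff m m.+2 = fdiff m.+1 m.+1 + fdiff m m.+1.
  by rewrite fdiffS; ring.
by ring.
Qed.

Arguments fdiff : simpl never.

(** * Permutations avoiding a relation between neighbours *)

Definition avoiding (T : eqType) (r : rel T) (s : seq T) : bool :=
  sorted (fun x y => ~~ r x y) s.

(** Lists replace finite types here, so that a contraction can delete an element with [rem]. *)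
Definition navoid (T : eqType) (r : rel T) (s : seq T) : nat :=
  count (avoiding r) (permutations s).

Section Avoiding.

Variable T : eqType.
Implicit Types (r : rel T) (s p q : seq T) (x y u w : T).

(** A duplicate-free list never has an element next to itself, so a reflexive order can be traded
    for a list of strict pairs. *)
Lemma eq_in_avoiding r1 r2 s : uniq s ->
    {in s &, forall x y, x != y -> r1 x y = r2 x y} ->
  avoiding r1 s = avoiding r2 s.
Proof.
case: s => // x s; rewrite /avoiding /sorted.
elim: s x => //= y s IHs x /andP[xys /andP[ys us]] er.
rewrite er ?inE ?eqxx ?orbT //; last first.
  by apply: contraNneq xys => ->; rewrite inE eqxx.
congr (_ && _); apply: IHs => /=; first by rewrite ys.
by move=> a b ain bin; apply: er; rewrite in_cons ?ain ?bin orbT.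
Qed.

Lemma eq_in_navoid r1 r2 s : uniq s ->
    {in s &, forall x y, x != y -> r1 x y = r2 x y} ->
  navoid r1 s = navoid r2 s.
Proof.
move=> us er; apply: eq_in_count => t; rewrite mem_permutations => pts.
apply: eq_in_avoiding; first by rewrite (perm_uniq pts).
by move=> x y; rewrite !(perm_mem pts); apply: er.
Qed.

Fixpoint insert_after u w s : seq T :=
  if s is x :: s' then
    if x == u then u :: w :: s' else x :: insert_after u w s'
  else [::].

Lemma insert_after_cat u w p q : u \notin p ->
  insert_after u w (p ++ u :: q) = p ++ u :: w :: q.
Proof.
elim: p => [|x p IHp] /=; first by rewrite eqxx.
by rewrite inE eq_sym negb_or => /andP[/negbTE -> /IHp ->].
Qed.

Lemma not_avoiding_pair u w s :
  ~~ avoiding (fun x y => (x == u) && (y == w)) s ->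
  exists p q, s = p ++ u :: w :: q.
Proof.
case: s => // x s; rewrite /avoiding /sorted.
elim: s x => //= y s IHs x; rewrite negb_and negbK.
case/orP => [/andP[/eqP -> /eqP ->]|/IHs [p [q ->]]].
  by exists [::], s.
by exists (x :: p), q.
Qed.

Lemma avoiding_cat_pair u w p q :
  avoiding (fun x y => (x == u) && (y == w)) (p ++ u :: w :: q) = false.
Proof. by rewrite /avoiding sorted_cat_cons /= !eqxx andbF. Qed.

(** The merged element keeps the name u: it meets its predecessor as u and its successor as w,
    whence a substitution in the first argument of [r] only. *)
Lemma avoiding_contract u w r p q : u \notin p -> u \notin q -> ~~ r u w ->
  avoiding r (p ++ u :: w :: q) =
    avoiding (fun x y => r (if x == u then w else x) y) (p ++ u :: q).
Proof.
move=> up uq ruw; rewrite /avoiding !sorted_cat_cons; congr (_ && _).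
  case: p up => //= x p; elim: p x => [|y p IHp] x /=.
    by rewrite inE eq_sym => /negbTE ->.
  by rewrite inE negb_or eq_sym => /andP[/negbTE -> /IHp ->].
rewrite /= ruw; case: q uq => //= y q; rewrite eqxx => uyq; congr (_ && _).
elim: q y uyq => //= z q IHq y.
by rewrite inE negb_or eq_sym => /andP[/negbTE -> /IHq ->].
Qed.

Lemma rem_insert_after u w p q : u != w -> w \notin p ->
  rem w (p ++ u :: w :: q) = p ++ u :: q.
Proof.
move=> uw; elim: p => [|x p IHp] /=; first by rewrite (negbTE uw) eqxx.
by rewrite inE negb_or eq_sym => /andP[/negbTE -> /IHp ->].
Qed.

Lemma perm_insert_after u w p q :
  perm_eq (p ++ u :: w :: q) (w :: p ++ u :: q).
Proof. by rewrite -cat_rcons perm_catC /= perm_cons perm_catC cat_rcons. Qed.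

(* Deletion-contraction: the sequences in which w directly follows u are those
   obtained by inserting w after u. *)
Lemma navoid_contract r s u w : uniq s -> u \in s -> w \in s -> u != w ->
    ~~ r u w ->
  navoid r s = (navoid (fun x y => r x y || ((x == u) && (y == w))) s
                + navoid (fun x y => r (if x == u then w else x) y) (rem w s))%N.
Proof.
move=> us uins wins uw ruw; set r2 := fun x y => r (if _ then _ else _) y.
set b := fun x y => (x == u) && (y == w).
rewrite /navoid -[LHS]size_filter -(count_predC (avoiding b)) !count_filter.
congr (_ + _)%N.
  apply: eq_count => t /=; rewrite /avoiding andbC -sorted_relI.
  by case: t => //= x t; apply: eq_path => x1 y1 /=; rewrite negb_or.
rewrite -!size_filter -[RHS](size_map (insert_after u w)); apply: perm_size.
have ur := rem_uniq w us.
have wr : w \notin rem w s by rewrite mem_rem_uniq // !inE eqxx.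
have ur' : u \in rem w s by rewrite mem_rem_uniq // !inE uw.
have insP t : t \in permutations (rem w s) -> exists p q,
    [/\ t = p ++ u :: q, insert_after u w t = p ++ u :: w :: q, w \notin t,
        u \notin p & u \notin q].
  rewrite mem_permutations => pt.
  have ut : uniq t by rewrite (perm_uniq pt).
  have uint : u \in t by rewrite (perm_mem pt).
  have wt : w \notin t by rewrite (perm_mem pt).
  case/splitPr: uint wt ut {pt} => p q wt.
  rewrite cat_uniq /= !negb_or -!andbA => /and5P[_ up _ uq _].
  by exists p, q; split=> //; apply: insert_after_cat.
apply: uniq_perm.
- exact/filter_uniq/permutations_uniq.
- rewrite map_inj_in_uniq; first exact/filter_uniq/permutations_uniq.
  move=> t1 t2; rewrite !mem_filter => /andP[_ /insP[p1 [q1 [e1 -> w1 _ _]]]].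
  move=> /andP[_ /insP[p2 [q2 [e2 -> w2 _ _]]]].
  have rw p q : w \notin p ++ u :: q -> rem w (p ++ u :: w :: q) = p ++ u :: q.
    by rewrite mem_cat negb_or => /andP[wp _]; apply: rem_insert_after.
  by move/(congr1 (rem w)); rewrite !rw -?e1 -?e2.
move=> t; rewrite mem_filter /=; apply/idP/mapP.
  case/andP => /andP[/not_avoiding_pair[p [q tE]] rt].
  rewrite mem_permutations => pt.
  have ut : uniq t by rewrite (perm_uniq pt).
  move: (ut); rewrite tE cat_uniq /= !inE !negb_or -!andbA.
  case/and5P => _ up wp _ /and4P[_ uq _ _].
  exists (p ++ u :: q); last by rewrite insert_after_cat.
  rewrite mem_filter -avoiding_contract // -tE rt mem_permutations /=.
  rewrite -(perm_cons w) -(permPl (perm_insert_after u w p q)) -tE.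
  by rewrite (permPl pt) perm_to_rem.
case=> t'; rewrite mem_filter => /andP[rt' pt'] ->.
have [p [q [tE -> wt up uq]]] := insP _ pt'.
rewrite avoiding_cat_pair avoiding_contract // -tE rt' /= mem_permutations.
rewrite (permPl (perm_insert_after u w p q)) perm_sym (permPl (perm_to_rem wins)).
by rewrite perm_cons perm_sym -tE -mem_permutations.
Qed.

End Avoiding.

(** Deletion-contraction on the first pair of E is the recurrence [fdiffS]: contraction removes one
    element of s and keeps the other pairs disjoint. For empty E every permutation qualifies. *)
Lemma navoid_pairs (T : eqType) (E : seq (T * T)) (s : seq T) : uniq s ->
    uniq (unzip1 E ++ unzip2 E) -> {subset unzip1 E ++ unzip2 E <= s} ->
  (navoid (fun x y => (x, y) \in E) s)%:Z = fdiff (size E) (size s - size E).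
Proof.
elim: E s => [|[u w] E IHE] s us uE sE.
  rewrite subn0 -[fdiff _ _]/((size s)`!%:R) -size_permutations // natz.
  congr Posz; apply/eqP.
  rewrite -all_count; apply/allP => -[|x t] // _.
  by rewrite /avoiding /=; elim: t x => //= y t IHt x; rewrite IHt.
have szE : (size ((u, w) :: E) <= size s)%N.
  apply: leq_trans (uniq_leq_size uE sE).
  by rewrite size_cat !size_map leq_addl.
have [uins wins] : u \in s /\ w \in s.
  by split; apply: sE; rewrite /= !(inE, mem_cat) eqxx ?orbT.
move: uE; rewrite /= mem_cat !inE cat_uniq /= !negb_or.
case/andP=> /and3P[u1 uw u2] /and3P[un1]; case/andP=> w1 dis /andP[w2 un2].
have un : uniq (unzip1 E ++ unzip2 E) by rewrite cat_uniq un1 dis.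
have sE' : {subset unzip1 E ++ unzip2 E <= s}.
  move=> x xE; apply: sE; move: xE; rewrite /= !(inE, mem_cat).
  by case/orP=> ->; rewrite ?orbT.
have N1 x y : x \notin unzip1 E -> ((x, y) \in E) = false.
  by apply: contraNF => /(map_f (@fst _ _)).
have N2 x y : y \notin unzip2 E -> ((x, y) \in E) = false.
  by apply: contraNF => /(map_f (@snd _ _)).
have w1' : w \notin unzip1 E := w1.
have ruw : ~~ ((u, w) \in E) by rewrite N1.
have := navoid_contract (r := fun x y => (x, y) \in E) us uins wins uw ruw.
move/(congr1 Posz); rewrite PoszD (IHE s) // => Es.
(* By disjointness neither u nor w is a first component in E, so the substitution has no effect. *)
have eR : navoid (fun x y => (if x == u then w else x, y) \in E) (rem w s)
        = navoid (fun x y => (x, y) \in E) (rem w s).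
  apply: eq_in_navoid; first exact: rem_uniq.
  by move=> x y _ _ _; case: eqP => // ->; rewrite !N1.
rewrite eR (IHE (rem w s)) ?rem_uniq // in Es; last first.
  move=> x xE; rewrite mem_rem_uniq // !inE (sE' x) // andbT.
  by apply: contraTneq xE => ->; rewrite mem_cat negb_or w1'.
have -> : navoid (fun x y => (x, y) \in (u, w) :: E) s
        = navoid (fun x y => ((x, y) \in E) || ((x == u) && (y == w))) s.
  by apply: eq_in_navoid => // x y _ _ _; rewrite inE orbC xpair_eqE.
rewrite size_rem // in Es; rewrite fdiffS.
have -> : (size s - (size E).+1).+1 = (size s - size E)%N.
  by rewrite subnSK.
rewrite Es; have -> : ((size s).-1 - size E = size s - (size E).+1)%N.
  by rewrite -subn1 -subnDA add1n.
by rewrite addrK.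
Qed.

Lemma navoid_map (T U : eqType) (f : T -> U) (r : rel U) (s : seq T) :
  injective f -> uniq s ->
  navoid r (map f s) = navoid (fun x y => r (f x) (f y)) s.
Proof.
move=> injf us; rewrite /navoid.
have /permP-> : perm_eq (permutations (map f s)) (map (map f) (permutations s)).
  apply: uniq_perm; rewrite ?permutations_uniq //.
    by rewrite map_inj_uniq ?permutations_uniq //; apply: inj_map.
  move=> t; rewrite mem_permutations; apply/idP/mapP.
    move=> pt; have [t' tE] : exists t', t = map f t'.
      have /subset_mapP [t' _ ->] : {subset t <= map f s}.
        by move=> x; rewrite (perm_mem pt).
      by exists t'.
    exists t' => //; rewrite mem_permutations.
    by move: pt; rewrite tE => /(perm_map_inj injf).
  by case=> t' pt ->; rewrite perm_map // -mem_permutations.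
rewrite count_map; apply: eq_count => t /=.
by rewrite /avoiding sorted_map.
Qed.

(** * Spanning non-increasing sequences of complete multipartite graphs *)

Lemma Nsp_navoid (T : finType) (le : rel T) : Nsp le = navoid le (enum T).
Proof.
rewrite /Nsp /navoid cardE -(size_map val) -size_filter; apply: perm_size.
have permE s : (s \in permutations (enum T)) = [forall x, count_mem x s == 1%N].
  rewrite mem_permutations; apply/idP/forallP => [/permP ps x|cs].
    by rewrite ps count_uniq_mem ?enum_uniq // mem_enum.
  have us : uniq s.
    by apply: count_mem_uniq => x; rewrite (eqP (cs x)) -has_pred1 has_count (eqP (cs x)).
  apply: uniq_perm; rewrite ?enum_uniq // => x; rewrite mem_enum inE.
  by rewrite -has_pred1 has_count (eqP (cs x)).
apply: uniq_perm.
- by rewrite map_inj_uniq ?enum_uniq //; apply: val_inj.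
- exact/filter_uniq/permutations_uniq.
move=> s; rewrite mem_filter; apply/mapP/idP.
  by case=> t; rewrite mem_enum inE permE => /andP[? ?] ->; apply/andP.
case/andP=> good ps.
have sz : size s == #|T|.
  by move: (ps); rewrite mem_permutations => /perm_size ->; rewrite -cardE.
by exists (Tuple sz) => //; rewrite mem_enum inE -permE /=; apply/andP.
Qed.

(** Plain pairs of naturals avoid the dependent type [cell] and make membership a matter of
    arithmetic. *)
Definition cells (la : seq nat) : seq (nat * nat) :=
  [seq (cell_row x, cell_col x) | x <- enum (cell la)].

Lemma cells_uniq la : uniq (cells la).
Proof.
rewrite map_inj_uniq ?enum_uniq // => x y [rxy cxy]; exact: cell_inj.
Qed.

Lemma mem_cells la i j : ((i, j) \in cells la) = (j < nth 0 la i)%N.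
Proof.
apply/mapP/idP => [[[a b] _ [-> ->]]|ltj]; first exact: ltn_ord.
have lti : (i < size la)%N.
  by rewrite ltnNge; apply: contraTN ltj => /(nth_default 0%N) ->.
by exists (existT _ (Ordinal lti) (Ordinal ltj)); rewrite ?mem_enum.
Qed.

Lemma card_cell la : #|{: cell la}| = sumn la.
Proof.
rewrite card_tagged -[in RHS](mkseq_nth 0%N la) /mkseq -val_enum_ord -map_comp.
by congr sumn; apply: eq_map => i /=; rewrite card_ord.
Qed.

Lemma size_cells la : size (cells la) = sumn la.
Proof. by rewrite size_map -cardE card_cell. Qed.

Definition pos_le : rel (nat * nat) :=
  fun x y => (x.1 == y.1) && (x.2 <= y.2)%N.

Lemma NspK_navoid la : NspK la = navoid pos_le (cells la).
Proof.
rewrite /NspK Nsp_navoid /cells.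
have inj : injective (fun x : cell la => (cell_row x, cell_col x)).
  by move=> x y [rxy cxy]; apply: cell_inj.
by rewrite (navoid_map _ inj) ?enum_uniq.
Qed.

(** The strict relations of b chains of length two; they are disjoint, as [navoid_pairs]
    requires. *)
Definition col_pairs (a b : nat) : seq ((nat * nat) * (nat * nat)) :=
  [seq ((i, 0), (i, 1))%N | i <- iota a b].

Lemma mem_col_pairs a b x y : ((x, y) \in col_pairs a b) =
  [&& (a <= x.1 < a + b)%N, x.2 == 0%N, y.1 == x.1 & y.2 == 1%N].
Proof.
case: x y => [i k] [j l] /=; apply/mapP/idP.
  by case=> i'; rewrite mem_iota => ? [-> -> -> ->]; rewrite !eqxx !andbT.
case/and4P=> ? /eqP -> /eqP -> /eqP ->.
by exists i; rewrite ?mem_iota.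
Qed.

Lemma unzip1_col_pairs a b : unzip1 (col_pairs a b) = [seq (i, 0)%N | i <- iota a b].
Proof. by rewrite /unzip1 -map_comp. Qed.

Lemma unzip2_col_pairs a b : unzip2 (col_pairs a b) = [seq (i, 1)%N | i <- iota a b].
Proof. by rewrite /unzip2 -map_comp. Qed.

Lemma col_pairs_uniq a b : uniq (unzip1 (col_pairs a b) ++ unzip2 (col_pairs a b)).
Proof.
rewrite unzip1_col_pairs unzip2_col_pairs cat_uniq !map_inj_uniq ?iota_uniq.
- rewrite andbT /=; apply/hasPn => _ /mapP[i _ ->]; apply/mapP => -[j _] //.
- by move=> i j [].
- by move=> i j [].
Qed.

Lemma mem_unzip_col_pairs a b x :
  (x \in unzip1 (col_pairs a b) ++ unzip2 (col_pairs a b)) =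
  (a <= x.1 < a + b)%N && (x.2 < 2)%N.
Proof.
rewrite unzip1_col_pairs unzip2_col_pairs mem_cat; case: x => i j /=.
apply/orP/andP => [[]/mapP[k]|[]].
- by rewrite mem_iota => ? [-> ->].
- by rewrite mem_iota => ? [-> ->].
rewrite -mem_iota => ki; case: j => [|[|]] // _.
  by left; apply: map_f.
by right; apply: map_f.
Qed.

Lemma nth_twos m s i :
  nth 0%N (nseq m 2%N ++ s) i = (if (i < m)%N then 2%N else nth 0%N s (i - m)).
Proof. by rewrite nth_cat size_nseq nth_nseq; case: (i < m)%N. Qed.

(** Off the diagonal the chain order consists of m disjoint pairs among 2m + k elements, so
    [navoid_pairs] applies. *)
Lemma NspK_twos_ones m k : (k <= 1)%N ->
  (NspK (nseq m 2%N ++ nseq k 1%N))%:Z = fdiff m (m + k)%N.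
Proof.
move=> k1; rewrite NspK_navoid.
set la := _ ++ _.
have mem i j : ((i, j) \in cells la) =
    ((i < m) && (j < 2) || [&& m <= i, i < m + k & j == 0])%N.
  rewrite mem_cells nth_twos; case: (ltnP i m) => mi; first by rewrite orbF.
  by rewrite nth_nseq; case: (ltnP (i - m) k) => ?; apply/idP/idP; lia.
have -> : navoid pos_le (cells la)
        = navoid (fun x y => (x, y) \in col_pairs 0 m) (cells la).
  apply: eq_in_navoid; first exact: cells_uniq.
  move=> [i j] [i' j']; rewrite !mem mem_col_pairs /pos_le xpair_eqE /= add0n.
  by move=> *; apply/idP/idP; move: k1; lia.
rewrite navoid_pairs ?cells_uniq ?col_pairs_uniq //; last first.
  move=> [i j]; rewrite mem_unzip_col_pairs mem /= add0n.
  by move=> /andP[-> ->].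
rewrite size_cells size_map size_iota sumn_cat !sumn_nseq.
by congr fdiff; lia.
Qed.

(** The three relations inside the chain of length three overlap. Contracting (0,0) with (0,1), then
    (0,0) with (0,2), leaves three counts with disjoint pairs only. *)
Lemma NspK_three_twos m : (NspK (3%N :: nseq m 2%N))%:Z = Nsp3 m.
Proof.
rewrite NspK_navoid; set la := _ :: _; set s := cells la.
have us : uniq s := cells_uniq la.
have mem i j : ((i, j) \in s) =
    ((i == 0) && (j < 3) || [&& 0 < i, i < m.+1 & j < 2])%N.
  rewrite mem_cells; case: i => [|i] /=; first by rewrite orbF.
  by rewrite nth_nseq ltnS; case: (i < m)%N; rewrite ?andbT ?andbF.
have szs : size s = (m.*2 + 3)%N.
  by rewrite size_cells /= sumn_nseq; lia.
pose P x y := (x, y) \in col_pairs 1 m.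
pose R12 x y := (x, y) \in ((0, 1), (0, 2))%N :: col_pairs 1 m.
pose R02 x y := (x, y) \in ((0, 0), (0, 2))%N :: col_pairs 1 m.
pose R x y := R12 x y || ((x == (0, 0)%N) && (y == (0, 2)%N)).
have c : [/\ (0, 0)%N \in s, (0, 1)%N \in s & (0, 2)%N \in s] by rewrite !mem.
case: c => s0 s1 s2.
have eqR : navoid pos_le s = navoid (fun x y => R x y || ((x == (0, 0)) && (y == (0, 1))))%N s.
  apply: eq_in_navoid => // [[i j] [i' j']].
  rewrite !mem /R /R12 inE mem_col_pairs /pos_le !xpair_eqE /=.
  by move=> *; apply/idP/idP; lia.
have NR : ~~ R (0, 0)%N (0, 1)%N.
  by rewrite /R /R12 inE mem_col_pairs.
have NR12 : ~~ R12 (0, 0)%N (0, 2)%N.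
  by rewrite /R12 inE mem_col_pairs.
have := navoid_contract us s0 s1 isT NR; rewrite -eqR.
have := navoid_contract us s0 s2 isT NR12; rewrite -/R.
set n1 := navoid _ (rem _ _); set n2 := navoid _ (rem _ _) => e1 e2.
have {e2} -> : (navoid pos_le s)%:Z = (navoid R12 s)%:Z - n1%:Z - n2%:Z by lia.
(* Merged with the maximal element (0,2), the element (0,0) has no forbidden successor left. *)
have -> : n1 = navoid P (rem (0, 2)%N s).
  apply: eq_in_navoid; first exact: rem_uniq.
  move=> [i j] [i' j']; rewrite !mem_rem_uniq // !inE !mem /P /R12 inE.
  case: (eqVneq (i, j) (0, 0)%N) => [[-> ->]|ne];
    rewrite !mem_col_pairs !xpair_eqE /=; first by move=> *; apply/idP/idP; lia.
  by move: ne; rewrite xpair_eqE => *; apply/idP/idP; lia.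
(* Merged with (0,1), the element (0,0) inherits the forbidden successor (0,2). *)
have -> : n2 = navoid R02 (rem (0, 1)%N s).
  apply: eq_in_navoid; first exact: rem_uniq.
  move=> [i j] [i' j']; rewrite !mem_rem_uniq // !inE !mem /R /R02 /R12 !inE.
  case: (eqVneq (i, j) (0, 0)%N) => [[-> ->]|ne];
    rewrite !mem_col_pairs !xpair_eqE /=; first by move=> *; apply/idP/idP; lia.
  by move: ne; rewrite xpair_eqE => *; apply/idP/idP; lia.
have uz u w x : (x \in unzip1 ((u, w) :: col_pairs 1 m) ++
                  unzip2 ((u, w) :: col_pairs 1 m)) =
    [|| x == u, x == w | (1 <= x.1 < 1 + m)%N && (x.2 < 2)%N].
  rewrite /= !(inE, mem_cat) -mem_unzip_col_pairs mem_cat.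
  by case: (x == u); case: (x == w); rewrite ?orbT.
have un u w : u.1 = 0%N -> w.1 = 0%N -> u != w ->
    uniq (unzip1 ((u, w) :: col_pairs 1 m) ++ unzip2 ((u, w) :: col_pairs 1 m)).
  move=> u0 w0 uw.
  have /permPl/perm_uniq :=
    perm_catCA (u :: unzip1 (col_pairs 1 m)) [:: w] (unzip2 (col_pairs 1 m)).
  rewrite /= => ->; rewrite inE negb_or eq_sym uw col_pairs_uniq andbT /=.
  by rewrite !mem_unzip_col_pairs u0 w0.
rewrite !navoid_pairs ?rem_uniq ?un ?col_pairs_uniq //.
- rewrite !size_rem //= size_map size_iota szs /Nsp3.
  by congr (fdiff _ _ - fdiff _ _ - fdiff _ _); lia.
- move=> [i j]; rewrite uz mem_rem_uniq // !inE mem !xpair_eqE /=; lia.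
- move=> [i j]; rewrite mem_unzip_col_pairs mem_rem_uniq // !inE mem !xpair_eqE /=; lia.
- move=> [i j]; rewrite uz mem !xpair_eqE /=; lia.
Qed.

(** * Colorings of complete multipartite graphs *)

Section Place.

Variables (N : nat) (R : comNzRingType) (x : 'I_N -> R).
Implicit Types (V : {set 'I_N}) (H : {set 'I_N} -> R) (n : 'I_N).

(* Colors a part of l vertices from V, and the later parts (H) from what remains. *)
Definition place l H V : R :=
  \sum_(f : {ffun 'I_l -> 'I_N} | [forall i, f i \in V])
    (\prod_i x (f i)) * H (V :\: [set f i | i : 'I_l]).

Lemma eq_in_place l H1 H2 V :
  (forall V', V' \subset V -> H1 V' = H2 V') -> place l H1 V = place l H2 V.
Proof.
by move=> eH; apply: eq_bigr => f _; rewrite eH // subsetDl.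
Qed.

Lemma placeD l H1 H2 V :
  place l (fun V => H1 V + H2 V) V = place l H1 V + place l H2 V.
Proof. by rewrite -big_split; apply: eq_bigr => f _ /=; rewrite mulrDr. Qed.

Lemma placeZ l c H V : place l (fun V => c * H V) V = c * place l H V.
Proof. by rewrite mulr_sumr; apply: eq_bigr => f _; rewrite mulrCA. Qed.

(** Unfolded, both sides sum over pairs of colorings with values in V and disjoint images, a
    symmetric condition. *)
Lemma placeC l k H V : place l (place k H) V = place k (place l H) V.
Proof.
pose F l k (f : {ffun 'I_l -> 'I_N}) (g : {ffun 'I_k -> 'I_N}) :=
  (\prod_i x (f i)) * ((\prod_i x (g i)) *
     H (V :\: [set f i | i : 'I_l] :\: [set g i | i : 'I_k])).
pose P l k (f : {ffun 'I_l -> 'I_N}) (g : {ffun 'I_k -> 'I_N}) :=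
  [&& [forall i, f i \in V], [forall i, g i \in V]
    & [forall i, forall j, f i != g j]].
have E l' k' : place l' (place k' H) V = \sum_f \sum_(g | P l' k' f g) F l' k' f g.
  rewrite /place big_mkcond; apply: eq_bigr => f _.
  case: ifP => [fV|fV]; last by rewrite big_pred0 // => g; rewrite /P fV.
  rewrite mulr_sumr; apply: eq_bigl => g; rewrite /P fV /=.
  apply/forallP/andP => [gV|[/forallP gV /forallP fg] i].
    split; apply/forallP => i; first by have := gV i; rewrite inE => /andP[].
    apply/forallP => j; have := gV j; rewrite inE => /andP[+ _].
    by apply: contraNneq => <-; apply: imset_f.
  rewrite inE gV andbT; apply/imsetP => -[j _ e].
  by have /forallP/(_ i) := fg j; rewrite e eqxx.
rewrite !E (exchange_big_dep predT) //=; apply: eq_bigr => g _.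
apply: eq_big => f.
  rewrite /P andbCA; do 2 congr (_ && _).
  apply/forallP/forallP => h i; apply/forallP => j;
    by have /forallP/(_ i) := h j; rewrite eq_sym.
by move=> _; rewrite /F mulrCA !setDDl setUC.
Qed.

Definition ffcons l (p : 'I_N * {ffun 'I_l -> 'I_N}) : {ffun 'I_l.+1 -> 'I_N} :=
  [ffun i => if unlift ord0 i is Some j then p.2 j else p.1].

Lemma ffcons0 l p : @ffcons l p ord0 = p.1.
Proof. by rewrite ffunE unlift_none. Qed.

Lemma ffconsS l p (i : 'I_l) : ffcons p (lift ord0 i) = p.2 i.
Proof. by rewrite ffunE liftK. Qed.

Lemma ffcons_bij l : bijective (@ffcons l).
Proof.
exists (fun f : {ffun 'I_l.+1 -> 'I_N} => (f ord0, [ffun i => f (lift ord0 i)])).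
  case=> c f; rewrite ffcons0; congr pair.
  by apply/ffunP => i; rewrite ffunE ffconsS.
move=> f; apply/ffunP => i; rewrite ffunE /=.
by case: unliftP => [j ->|->] //; rewrite ffunE.
Qed.

(* Same as [place], with separate sets for the allowed and the remaining colors. *)
Fixpoint place_seq l H V W : R :=
  if l is l'.+1 then \sum_(c in V) x c * place_seq l' H V (W :\ c) else H W.

Lemma place_seqE l H V : place l H V = place_seq l H V V.
Proof.
(* Only the set of remaining colors is generalized: vertices of one part may share a color, so the
   allowed set stays V throughout the recursion. *)
rewrite /place; move: {2 4}V => W; elim: l W => [|l IHl] W /=.
  have f0 : 'I_0 -> 'I_N by case.
  rewrite (big_pred1 (finfun f0)).
    rewrite big_ord0 mul1r; congr H; apply/setP => c; rewrite inE.
    by rewrite (_ : _ \in _ = false) //; apply/imsetP => -[[]].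
  move=> f /=; have -> : f = finfun f0 by apply/ffunP => -[].
  by rewrite eqxx; apply/forallP => -[].
rewrite (reindex (@ffcons l)) /=; last exact/onW_bij/ffcons_bij.
rewrite (eq_bigl (fun p : 'I_N * {ffun 'I_l -> 'I_N} =>
  (p.1 \in V) && [forall i, p.2 i \in V])); last first.
  move=> p /=; apply/forallP/andP => [h|[h0 /forallP h] i].
    split; first by have := h ord0; rewrite ffcons0.
    by apply/forallP => i; have := h (lift ord0 i); rewrite ffconsS.
  by case: (unliftP ord0 i) => [j ->|->]; rewrite ?ffcons0 ?ffconsS.
rewrite -(pair_big (fun c => c \in V) (fun f : {ffun 'I_l -> 'I_N} => [forall i, f i \in V])
  (fun c f => (\prod_i x (ffcons (c, f) i)) * H (W :\: [set ffcons (c, f) i | i : 'I_l.+1]))) /=.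
apply: eq_bigr => c _; rewrite -IHl mulr_sumr; apply: eq_bigr => f _.
rewrite big_ord_recl ffcons0 /= -mulrA; congr (_ * (_ * H _)).
  by apply: eq_bigr => i _; rewrite ffconsS.
rewrite setDDl; congr (_ :\: _); apply/setP => d; rewrite !inE.
apply/imsetP/orP => [[i _ ->]|[/eqP->|/imsetP[i _ ->]]].
- case: (unliftP ord0 i) => [j ->|->]; rewrite ?ffcons0 ?ffconsS /=; last by left.
  by right; apply: imset_f.
- by exists ord0; rewrite ?ffcons0.
- by exists (lift ord0 i); rewrite ?ffconsS.
Qed.

Lemma place1E H V : place 1 H V = \sum_(c in V) x c * H (V :\ c).
Proof. exact: place_seqE. Qed.

Lemma place2E H V :
  place 2 H V = \sum_(c in V) x c * \sum_(d in V) x d * H (V :\ c :\ d).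
Proof. exact: place_seqE. Qed.

Lemma place3E H V :
  place 3 H V = \sum_(c in V) x c * \sum_(d in V) x d *
                  \sum_(e in V) x e * H (V :\ c :\ d :\ e).
Proof. exact: place_seqE. Qed.

Lemma place1U1 H V n : n \notin V ->
  place 1 H (n |: V) = x n * H V + place 1 (fun V => H (n |: V)) V.
Proof.
move=> nV; rewrite !place1E big_setU1 //= setU1K //; congr (_ + _).
apply: eq_bigr => c cV; congr (_ * H _); apply/setP => d; rewrite !inE.
by case: (eqVneq d n) => // ->; rewrite andbT; apply: contraNneq nV => ->.
Qed.

(** The three terms correspond to the new color n being used by both vertices of the part, by
    exactly one, or by none; in the last case n stays available to later parts. *)
Lemma place2U1 H V n : n \notin V ->
  place 2 H (n |: V) = x n ^+ 2 * H V + 2%:R * x n * place 1 H V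
                       + place 2 (fun V => H (n |: V)) V.
Proof.
move=> nV; rewrite !place2E place1E.
have dn c : c \in V -> (c == n) = false by move=> cV; apply: contraNF nV => /eqP <-.
have nc c : c \in V -> (n |: V) :\ c = n |: (V :\ c).
  move=> cV; apply/setP => d; rewrite !inE.
  by case: (eqVneq d n) => // ->; rewrite andbT eq_sym dn.
have nn c : c \in V -> (n |: V :\ c) :\ n = V :\ c.
  by move=> cV; rewrite setU1K // !inE negb_and nV orbT.
rewrite big_setU1 //= big_setU1 //= setU1K //.
have -> : V :\ n = V by apply/setP => d; rewrite !inE; case: eqP => // ->; rewrite (negbTE nV).
rewrite expr2 mulrDr mulrA -!addrA; congr (_ + _).
rewrite [2%:R]mulr2n mulrDl mul1r [in RHS]mulrDl -addrA; congr (_ + _).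
rewrite mulr_sumr -big_split /=; apply: eq_bigr => c cV.
rewrite big_setU1 //= nc // nn // mulrDr mulrCA; congr (_ + _ * _).
apply: eq_bigr => d dV; congr (_ * H _); apply/setP => e; rewrite !inE.
by case: (eqVneq e n) => // ->; rewrite andbT eq_sym dn // eq_sym dn.
Qed.

Definition psum V : R := \sum_(c in V) x c.

(* Both sides sum over the colorings of three vertices in which the color of the third
   is one of the first two. *)
Lemma place3_place2 H V :
  place 3 H V - place 2 (place 1 H) V
    = psum V * place 2 H V - place 2 (fun V => psum V * H V) V.
Proof.
rewrite place3E !place2E mulr_sumr -!sumrB; apply: eq_bigr => c cV.
rewrite mulrCA -!mulrBr; congr (_ * _).
rewrite mulr_sumr -!sumrB; apply: eq_bigr => d dV.
rewrite mulrCA -!mulrBr; congr (_ * _).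
rewrite place1E /psum -mulrBl; set W := V :\ c :\ d.
have WV : W \subset V by apply: subset_trans (subsetDl _ _) (subsetDl _ _).
rewrite !(big_setID (A := V) W) /= (setIidPr WV) [X in X - _]addrC addrK.
rewrite [X in (X - _) * _]addrC addrK mulr_suml; apply: eq_bigr => e.
rewrite inE => /andP[eW _]; congr (_ * H _); apply/setP => k.
by rewrite in_setD1; case: eqP => // ->; rewrite (negbTE eW).
Qed.

(* The chromatic symmetric function of K_(2^a, 1^b), colored from V. *)
Definition colorings2 a b : {set 'I_N} -> R := iter a (place 2) (iter b (place 1) (fun=> 1)).

Definition colorings3 a : {set 'I_N} -> R := place 3 (colorings2 a 0).

Lemma colorings2S a b V : colorings2 a.+1 b V = place 2 (colorings2 a b) V.
Proof. by []. Qed.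

Lemma place1_colorings2 a b V : place 1 (colorings2 a b) V = colorings2 a b.+1 V.
Proof.
elim: a V => //= a IHa V; rewrite [LHS]placeC.
by apply: eq_in_place => V' _; apply: IHa.
Qed.

(** The color n occurs in at most one part: on one vertex of a pair, whose mate then behaves as a
    singleton, on a singleton, or on a whole pair. The defaults in [a.-1] and [b.-1] come with a
    factor 0. *)
Lemma colorings2U1 a b V n : n \notin V ->
  colorings2 a b (n |: V) = colorings2 a b V
    + x n * ((2 * a)%:R * colorings2 a.-1 b.+1 V + b%:R * colorings2 a b.-1 V)
    + x n ^+ 2 * (a%:R * colorings2 a.-1 b V).
Proof.
elim: a V => [|a IHa] V nV.
  rewrite muln0 !mul0r mulr0 addr0 add0r.
  elim: b V nV => [|b IHb] V nV; first by rewrite mul0r mulr0 addr0.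
  rewrite -[LHS]/(place 1 (colorings2 0 b) (n |: V)) place1U1 //.
  rewrite (@eq_in_place _ _ (fun V =>
    colorings2 0 b V + x n * (b%:R * colorings2 0 b.-1 V))); last first.
    by move=> V' V'V; apply: IHb; apply: contra nV; apply: subsetP.
  rewrite placeD !placeZ.
  case: b {IHb} => [|b]; rewrite /= -/(colorings2 0 _) ?mul0r ?mulr0 ?addr0.
    by rewrite addrC mul1r.
  rewrite -[place 1 (colorings2 0 b.+1) V]/(colorings2 0 b.+2 V).
  rewrite -[place 1 (colorings2 0 b) V]/(colorings2 0 b.+1 V).
  by ring.
rewrite colorings2S place2U1 //.
rewrite [X in _ + X](@eq_in_place _ _ (fun V =>
   colorings2 a b V + (x n * (2 * a)%:R) * colorings2 a.-1 b.+1 V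
   + (x n * b%:R) * colorings2 a b.-1 V + (x n ^+ 2 * a%:R) * colorings2 a.-1 b V)); last first.
  move=> V' V'V; rewrite IHa; last by apply: contra nV; apply: subsetP.
  by ring.
rewrite !placeD !placeZ place1_colorings2 -!colorings2S.
(* The factor a covers a = 0, where [a.-1] is not a true predecessor. *)
have YP k c : (k * a)%:R * place 2 (colorings2 a.-1 c) V = (k * a)%:R * colorings2 a c V.
  by case: a {IHa} => [|a]; rewrite ?muln0 ?mul0r // -colorings2S.
rewrite -!mulrA YP -[a%:R * place _ _ _]/(a%:R * _).
have := YP 1%N b; rewrite mul1n => ->.
by rewrite [a.+1.-1]/=; ring.
Qed.

(** By [place3_place2], [colorings3] is known up to a correction in which the factor [psum] sits
    inside [place 2]; induction on a evaluates that correction. *)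
Lemma colorings3_psum a V :
  a.+1%:R * colorings3 a V = psum V * colorings2 a.+1 0 V + a%:R * colorings2 a.+1 1 V.
Proof.
have Y3E b W : colorings3 b W = colorings2 b.+1 1 W + psum W * colorings2 b.+1 0 W
                        - place 2 (fun V => psum V * colorings2 b 0 V) W.
  rewrite /colorings3; have /eqP := place3_place2 (colorings2 b 0) W.
  rewrite subr_eq => /eqP ->; rewrite -colorings2S.
  have -> : place 2 (place 1 (colorings2 b 0)) W = colorings2 b.+1 1 W.
    by apply: eq_in_place => V' _; apply: place1_colorings2.
  by ring.
elim: a V => [|a IHa] V.
  rewrite mul1r mul0r addr0 Y3E.
  have -> : place 2 (fun V => psum V * colorings2 0 0 V) V = colorings2 1 1 V; last by ring.
  apply: eq_in_place => V' _; rewrite /= mulr1 place1E.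
  by apply: eq_bigr => c _; rewrite mulr1.
(* Applying [place 2] to the induction hypothesis and commuting it past [place 3] turns the
   correction into a multiple of [colorings3 a.+1]. *)
have e : place 2 (fun V => psum V * colorings2 a.+1 0 V) V
       = a.+1%:R * colorings3 a.+1 V - a%:R * colorings2 a.+2 1 V.
  rewrite (@eq_in_place _ _ (fun V =>
    a.+1%:R * colorings3 a V + (- a%:R) * colorings2 a.+1 1 V)).
    by rewrite placeD !placeZ /colorings3 placeC mulNr.
  by move=> V' _; rewrite IHa; ring.
have -> : a.+2%:R * colorings3 a.+1 V = colorings3 a.+1 V + a.+1%:R * colorings3 a.+1 V by ring.
by rewrite [X in X + _]Y3E e; ring.
Qed.

End Place.

(** * Proper colorings, one part at a time *)

Definition cell_cons l la (u : 'I_l + cell la) : cell (l :: la) :=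
  match u with
  | inl j => existT (fun i : 'I_(size (l :: la)) => 'I_(nth 0%N (l :: la) i)) ord0 j
  | inr (existT i j) =>
      existT (fun i : 'I_(size (l :: la)) => 'I_(nth 0%N (l :: la) i))
             (Ordinal (ltn_ord i : i.+1 < size (l :: la))%N) j
  end.

Lemma cell_cons_bij l la : bijective (@cell_cons l la).
Proof.
apply: inj_card_bij; last by rewrite card_sum card_ord !card_cell.
case=> [j|[i j]] [j'|[i' j']] e; have := congr1 (@cell_col _) e;
  have := congr1 (@cell_row _) e; rewrite /cell_row /cell_col //=.
  by move=> _ /val_inj ->.
by case=> rij cij; congr inr; apply: cell_inj.
Qed.

Section Colorings.

Variables (N : nat) (R : comNzRingType) (x : 'I_N -> R).

(** Once the first part is colored, the rest is properly colored from the colors of V that it left;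
    hence the induction over all V. *)
Lemma proper_coloring_sum la (V : {set 'I_N}) :
  \sum_(C : {ffun cell la -> 'I_N}
         | proper_coloring (@K_adj la) C && [forall v, C v \in V])
      \prod_v x (C v)
    = foldr (place x) (fun=> 1) la V.
Proof.
elim: la V => [|l la IHla] V /=.
  have f0 : cell [::] -> 'I_N by case=> -[].
  rewrite (big_pred1 (finfun f0)); first by rewrite big1 // => -[[]].
  move=> f /=; have -> : f = finfun f0 by apply/ffunP => -[[]].
  by rewrite eqxx; apply/andP; split; apply/forallP => -[[]].
have [g gK Kg] := cell_cons_bij l la.
pose F (u : {ffun 'I_l -> 'I_N} * {ffun cell la -> 'I_N}) :=
  [ffun v => match g v with inl j => u.1 j | inr y => u.2 y end].
have Fl u j : F u (cell_cons (inl j)) = u.1 j by rewrite ffunE gK.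
have Fr u y : F u (cell_cons (inr y)) = u.2 y by rewrite ffunE gK.
rewrite (reindex F); last first.
  exists (fun f : {ffun cell (l :: la) -> 'I_N} =>
            ([ffun j : 'I_l => f (cell_cons (inl j))],
             [ffun y : cell la => f (cell_cons (inr y))])).
    by move=> [f h] _; congr pair; apply/ffunP => i; rewrite ffunE ?Fl ?Fr.
  by move=> f _; apply/ffunP => v; rewrite ffunE -{2}(Kg v); case: (g v) => i; rewrite ffunE.
pose D (f : {ffun 'I_l -> 'I_N}) := V :\: [set f i | i : 'I_l].
rewrite (eq_bigl (fun u : {ffun 'I_l -> 'I_N} * {ffun cell la -> 'I_N} =>
  [forall i, u.1 i \in V] &&
  (proper_coloring (@K_adj la) u.2 && [forall v, u.2 v \in D u.1]))); last first.
  move=> [f h] /=; apply/andP/and3P.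
    case=> /forallP pF /forallP FV; split.
    - by apply/forallP => i; have := FV (cell_cons (inl i)); rewrite Fl.
    - apply/forallP => y; apply/forallP => z.
      have /forallP/(_ (cell_cons (inr z))) := pF (cell_cons (inr y)).
      by rewrite !Fr; case: y z => [i j] [i' j'].
    - apply/forallP => y; have := FV (cell_cons (inr y)); rewrite Fr inE => ->.
      rewrite andbT; apply/imsetP => -[i _ e].
      have /forallP/(_ (cell_cons (inl i))) := pF (cell_cons (inr y)).
      by rewrite Fl Fr /= e eqxx; case: y e.
  case=> /forallP fV /forallP ph /forallP hD; split.
    apply/forallP => v; apply/forallP => w; rewrite -(Kg v) -(Kg w).
    have fh i y : f i != h y.
      have := hD y; rewrite inE => /andP[+ _].
      by apply: contraNneq => <-; apply: imset_f.
    apply/implyP; case: (g v) (g w) => [i|y] [i'|y']; rewrite ?Fl ?Fr //=.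
    - by move=> _; rewrite eq_sym.
    - have /forallP/(_ y')/implyP := ph y.
      by case: y y' => [i j] [i' j'].
  apply/forallP => v; rewrite -(Kg v); case: (g v) => [i|y]; rewrite ?Fl ?Fr //=.
  by have := hD y; rewrite inE => /andP[].
rewrite -(pair_big_dep (fun f : {ffun 'I_l -> 'I_N} => [forall i, f i \in V])
  (fun f (h : {ffun cell la -> 'I_N}) =>
     proper_coloring (@K_adj la) h && [forall v, h v \in D f])
  (fun f h => \prod_v x (F (f, h) v))) /=.
apply: eq_bigr => f _; rewrite -IHla mulr_sumr; apply: eq_bigr => h _.
rewrite (reindex (@cell_cons l la)) /=; last by exists g => ? _.
rewrite big_sumType /=; congr (_ * _); apply: eq_bigr => i _.
  by rewrite Fl.
by rewrite Fr.
Qed.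

End Colorings.

Lemma XK_place la N :
  XK la N = foldr (place (fun i : 'I_N => 'X_i : {mpoly int[N]})) (fun=> 1) la setT.
Proof.
rewrite -proper_coloring_sum; apply: eq_bigl => C.
by rewrite (_ : [forall v, _]) ?andbT //; apply/forallP => v; rewrite inE.
Qed.

Lemma foldr_nseq (S T : Type) (f : S -> T -> T) z n x :
  foldr f z (nseq n x) = iter n (f x) z.
Proof. by elim: n => //= n ->. Qed.

Lemma XK_twos_ones a b N :
  XK (nseq a 2%N ++ nseq b 1%N) N =
    colorings2 (fun i : 'I_N => 'X_i : {mpoly int[N]}) a b setT.
Proof. by rewrite XK_place foldr_cat !foldr_nseq. Qed.

Lemma XK_three_twos a N :
  XK (3%N :: nseq a 2%N) N = colorings3 (fun i : 'I_N => 'X_i : {mpoly int[N]}) a setT.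
Proof. by rewrite XK_place /= foldr_nseq. Qed.

(** * Branching and Pieri rules *)

Lemma lt_nth_size (la : seq nat) i j : (j < nth 0 la i -> i < size la)%N.
Proof. by move=> h; rewrite ltnNge; apply: contraTN h => /(nth_default 0%N) ->. Qed.

Definition mkcell la i j (h : (j < nth 0 la i)%N) : cell la :=
  existT (fun i : 'I_(size la) => 'I_(nth 0%N la i))
    (Ordinal (lt_nth_size h)) (Ordinal h).

Lemma ltn_cell la (y : cell la) : (cell_col y < nth 0 la (cell_row y))%N.
Proof. exact: ltn_ord. Qed.

Lemma semistandardP mu N (t : {ffun cell mu -> 'I_N}) :
  reflect ((forall y z : cell mu, cell_row y = cell_row z ->
              (cell_col y <= cell_col z)%N -> (t y <= t z)%N) /\
           (forall y z : cell mu, cell_col y = cell_col z ->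
              (cell_row y < cell_row z)%N -> (t y < t z)%N))
          (semistandard t).
Proof.
apply: (iffP forallP) => [h|[h1 h2] y].
  split=> y z /eqP e l; have /forallP/(_ z)/andP[/implyP ht1 /implyP ht2] := h y.
    by apply: ht1; rewrite e.
  by apply: ht2; rewrite e.
apply/forallP => z; apply/andP; split; apply/implyP => /andP[/eqP].
  exact: h1.
exact: h2.
Qed.

Section Tableaux.

Variables (N : nat) (R : comNzRingType) (x : 'I_N -> R).

(** The Schur polynomial in the first n of N fixed variables, so that n can vary while the ring
    stays the same. *)
Definition tableaux mu (n : nat) : R :=
  \sum_(t : {ffun cell mu -> 'I_N} | semistandard t && [forall y, t y < n]%N)
    \prod_y x (t y).

(* The two hypotheses say that mu / nu is a horizontal strip. *)
Lemma tableaux_strip mu nu (n : 'I_N) :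
  (forall i, nth 0 nu i <= nth 0 mu i)%N ->
  (forall i, nth 0 mu i.+1 <= nth 0 nu i)%N ->
  \sum_(t : {ffun cell mu -> 'I_N} | (semistandard t && [forall y, t y < n.+1]%N)
         && [forall y, (t y == n) == (nth 0 nu (cell_row y) <= cell_col y)%N])
    \prod_y x (t y)
  = x n ^+ (sumn mu - sumn nu) * tableaux nu n.
Proof.
move=> numu munu.
have mu_mono i k : (i <= k)%N -> (nth 0 mu k <= nth 0 mu i)%N.
  move=> /subnK <-; elim: (k - i)%N => //= m; apply: leq_trans.
  exact: leq_trans (munu _) (numu _).
pose emb (y : cell nu) : cell mu := mkcell (leq_trans (ltn_cell y) (numu _)).
have emb_in y : (nth 0 nu (cell_row (emb y)) <= cell_col (emb y))%N = false.
  by rewrite leqNgt; apply: negbF; apply: ltn_cell.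
have emb_inj : injective emb.
  move=> y z e; apply: cell_inj.
    exact: (congr1 (@cell_row _) e).
  exact: (congr1 (@cell_col _) e).
pose proj (y : cell mu) := [pick z | emb z == y].
have projK z : proj (emb z) = Some z.
  rewrite /proj; case: pickP => [w /eqP/emb_inj -> //|/(_ z)].
  by rewrite eqxx.
have projP y : (cell_col y < nth 0 nu (cell_row y))%N -> exists z, y = emb z.
  by move=> h; exists (mkcell h); apply: cell_inj.
have projN y : (nth 0 nu (cell_row y) <= cell_col y)%N -> proj y = None.
  rewrite /proj; case: pickP => // z /eqP <-.
  by rewrite emb_in.
(* Fillings of nu are extended by the entry n on the strip. *)
pose G (t : {ffun cell nu -> 'I_N}) : {ffun cell mu -> 'I_N} :=
  [ffun y => if proj y is Some z then t z else n].
have Ge t z : G t (emb z) = t z by rewrite ffunE projK.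
have Gn t y : (nth 0 nu (cell_row y) <= cell_col y)%N -> G t y = n.
  by move=> h; rewrite ffunE projN.
rewrite (reindex_onto G (fun t => [ffun z => t (emb z)])); last first.
  move=> t /andP[_ /forallP tn]; apply/ffunP => y.
  case: (ltnP (cell_col y) (nth 0 nu (cell_row y))) => [/projP [z ->]|h].
    by rewrite Ge ffunE.
  by rewrite Gn //; have := tn y; rewrite h eqb_id => /eqP ->.
rewrite /tableaux mulr_sumr; apply: eq_big => t.
  have -> : [ffun z => G t (emb z)] == t.
    by apply/eqP/ffunP => z; rewrite ffunE Ge.
  rewrite andbT; apply/andP/andP.
    case=> /andP[/semistandardP[ss1 ss2] /forallP Gle] /forallP GN; split.
      apply/semistandardP; split=> y z e l.
        by rewrite -!Ge; apply: ss1.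
      by rewrite -!Ge; apply: ss2.
    apply/forallP => y; have := Gle (emb y); have := GN (emb y); rewrite Ge.
    rewrite emb_in eqbF_neg ltnS leq_eqVlt => /negbTE ne.
    by rewrite -[_ == _ :> nat]/(t y == n) ne.
  case=> /semistandardP[ss1 ss2] /forallP tlt; split.
    apply/andP; split; last first.
      apply/forallP => y.
      case: (ltnP (cell_col y) (nth 0 nu (cell_row y))) => [/projP [z ->]|h].
        by rewrite Ge ltnS ltnW.
      by rewrite Gn.
    apply/semistandardP; split=> y z e l.
      case: (ltnP (cell_col z) (nth 0 nu (cell_row z))) => [hz|h].
        have hy : (cell_col y < nth 0 nu (cell_row y))%N.
          by rewrite e; apply: leq_ltn_trans hz.
        have [y' ey] := projP _ hy; have [z' ez] := projP _ hz.
        by move: e l; rewrite ey ez !Ge; apply: ss1.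
      rewrite (Gn t z) //.
      case: (ltnP (cell_col y) (nth 0 nu (cell_row y))) => [/projP [y' ->]|h'].
        by rewrite Ge ltnW.
      by rewrite Gn.
    (* The strip has no two cells in one column: y lies above a cell of mu, so [munu] places it in
       nu. *)
    have hy : (cell_col y < nth 0 nu (cell_row y))%N.
      rewrite e; apply: leq_trans (ltn_cell z) _; apply: leq_trans (munu _).
      exact: mu_mono.
    have [y' ey] := projP _ hy.
    case: (ltnP (cell_col z) (nth 0 nu (cell_row z))) => [/projP[z' ez]|h].
      by move: e l; rewrite ey ez !Ge; apply: ss2.
    by rewrite (Gn t z) // ey Ge.
  apply/forallP => y.
  case: (ltnP (cell_col y) (nth 0 nu (cell_row y))) => [/projP [z ->]|h].
    by rewrite Ge eqbF_neg -val_eqE neq_ltn tlt.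
  by rewrite Gn ?eqxx.
move=> _; rewrite (bigID (fun y => (cell_col y < nth 0 nu (cell_row y))%N)) /= mulrC.
congr (_ * _).
  rewrite (eq_bigr (fun=> x n)); last first.
    by move=> y; rewrite -leqNgt => h; rewrite Gn.
  rewrite prodr_const; congr (_ ^+ _).
  rewrite -!card_cell -(card_codom emb_inj) -(cardC (mem (codom emb))) addKn.
  apply: eq_card => y; rewrite !inE; congr (~~ _).
  apply/idP/codomP => [/projP //|[z ->]]; exact: ltn_cell.
rewrite (reindex_omap emb proj) /=; last by move=> y /projP[z ->]; rewrite projK.
apply: eq_big => z; last by rewrite Ge.
by rewrite projK eqxx andbT; apply: ltn_cell.
Qed.

End Tableaux.

(* The partition whose conjugate is (a, b, c), for [a >= b >= c]. *)
Definition col_shape a b c : seq nat := mkseq (fun i => ((i < b) + (i < c)).+1)%N a.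

Lemma nth_col_shape a b c i j : (c <= b <= a)%N ->
  (j < nth 0 (col_shape a b c) i)%N = (i < nth 0 [:: a; b; c] j)%N.
Proof.
case/andP=> cb ba; case: (ltnP i a) => ia.
  rewrite nth_mkseq //; case: j => [|[|[|j]]] /=; rewrite ?nth_nil; lia.
rewrite nth_default ?size_mkseq //.
by case: j => [|[|[|j]]] /=; rewrite ?nth_nil; lia.
Qed.

Lemma sumn_col_shape a b c : sumn (col_shape a b c) = (a + minn a b + minn a c)%N.
Proof.
elim: a => [|a IHa]; first by rewrite !min0n.
by rewrite /col_shape mkseqS sumn_rcons -/(col_shape a b c) IHa; lia.
Qed.

Section Branching.

Variables (N : nat) (R : comNzRingType) (x : 'I_N -> R).

(** The largest entry n can only occur at the bottom of a column, so three bits record where it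
    occurs. The conditions on e say that a partition shape remains, and [tableaux_strip] evaluates
    each class. *)
Lemma tableaux_branching a b c (n : 'I_N) : (c <= b <= a)%N ->
  tableaux x (col_shape a b c) n.+1 =
  \sum_(e : bool * bool * bool |
      [&& e.1.1 <= a, e.1.2 <= b, e.2 <= c,
          c - e.2 <= b - e.1.2 & b - e.1.2 <= a - e.1.1]%N)
    x n ^+ (e.1.1 + e.1.2 + e.2) * tableaux x (col_shape (a - e.1.1) (b - e.1.2) (c - e.2)) n.
Proof.
move=> cba; pose mu := col_shape a b c.
pose col := nth 0%N [:: a; b; c].
have colP (y : cell mu) : (cell_row y < col (cell_col y))%N.
  by rewrite -nth_col_shape // ltn_cell.
have mk i j : (i < col j)%N -> exists y : cell mu, cell_row y = i /\ cell_col y = j.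
  by rewrite -nth_col_shape // => h; exists (mkcell h).
pose bot (t : {ffun cell mu -> 'I_N}) j := [exists y, (cell_col y == j) && (t y == n)].
pose key t := (bot t 0, bot t 1, bot t 2)%N.
pose good (t : {ffun cell mu -> 'I_N}) := semistandard t && [forall y, t y < n.+1]%N.
have botP t y : good t ->
    (t y == n) = (col (cell_col y) <= (cell_row y).+1)%N && bot t (cell_col y).
  case/andP=> /semistandardP[ss1 ss2] /forallP tn; apply/idP/andP.
    move=> /eqP tyn; split; last by apply/existsP; exists y; rewrite tyn !eqxx.
    rewrite leqNgt; apply/negP => /mk [z [rz cz]].
    have := ss2 y z (esym cz); rewrite rz ltnSn tyn => /(_ isT).
    by rewrite ltnNge -ltnS tn.
  case=> le /existsP[z /andP[/eqP cz /eqP tzn]].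
  have zy : (cell_row z <= cell_row y)%N.
    by rewrite -ltnS; apply: leq_trans le; rewrite -cz.
  rewrite -tzn; apply/eqP; congr (t _); apply: cell_inj => //; apply/eqP.
  rewrite eqn_leq zy andbT leqNgt; apply/negP => /(ss2 z y cz).
  by rewrite tzn ltnNge -ltnS tn.
rewrite /tableaux (partition_big key (fun e => [&& e.1.1 <= a, e.1.2 <= b, e.2 <= c,
          c - e.2 <= b - e.1.2 & b - e.1.2 <= a - e.1.1]%N)); last first.
  move=> t gt.
  have bot_gt0 j : bot t j -> (0 < col j)%N.
    by case/existsP=> y /andP[/eqP <- _]; apply: leq_ltn_trans (colP y).
  (* In adjacent columns of equal height an n at the bottom of the left one forces an n to its
     right; this keeps the remaining column heights decreasing. *)
  have bot_next j : col j.+1 = col j -> bot t j -> bot t j.+1.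
    move=> ecol bj; have := bot_gt0 _ bj => c0.
    have [y [ry cy]] : exists y : cell mu, cell_row y = (col j).-1 /\ cell_col y = j.
      by apply: mk; rewrite prednK.
    have [z [rz cz]] : exists y : cell mu, cell_row y = (col j).-1 /\ cell_col y = j.+1.
      by apply: mk; rewrite ecol prednK.
    have : t y == n by rewrite botP // cy bj ry prednK // leqnn.
    move=> /eqP tyn; apply/existsP; exists z; rewrite cz eqxx /=.
    case/andP: gt => /semistandardP[ss1 _] /forallP /(_ z).
    rewrite ltnS => le; apply/eqP/val_inj/eqP; rewrite eqn_leq le /=.
    by have := ss1 y z; rewrite ry rz cy cz leqnSn tyn; apply.
  have := bot_gt0 0%N; have := bot_gt0 1%N; have := bot_gt0 2%N.
  have := bot_next 0%N; have := bot_next 1%N; rewrite /col /key /=.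
  case: (bot t 0%N) (bot t 1%N) (bot t 2%N) => [] [] [] /=; rewrite ?subn0; lia.
apply: eq_bigr => -[[e0 e1] e2] /= /and5P[ea eb ec cb' ba'].
have cba' : (c - e2 <= b - e1 <= a - e0)%N by rewrite cb'.
pose ebit := nth false [:: e0; e1; e2].
have colE j : nth 0%N [:: a - e0; b - e1; c - e2]%N j = (col j - ebit j)%N.
  by case: j => [|[|[|j]]] //=; rewrite /col /ebit /= ?nth_nil.
have ebit_col j : (ebit j <= col j)%N.
  by case: j => [|[|[|j]]] //=; rewrite /col /ebit /= ?nth_nil.
have -> : (e0 + e1 + e2 = sumn mu - sumn (col_shape (a - e0) (b - e1) (c - e2)))%N.
  by rewrite !sumn_col_shape; lia.
have lt_nu i j : (j < nth 0 (col_shape (a - e0) (b - e1) (c - e2)) i)%N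
    = (i < col j - ebit j)%N.
  by rewrite nth_col_shape // colE.
have lt_mu i j : (j < nth 0 mu i)%N = (i < col j)%N by rewrite nth_col_shape.
rewrite -tableaux_strip.
- apply: eq_bigl => t; apply: andb_id2l => gt.
  have nuE y : (nth 0 (col_shape (a - e0) (b - e1) (c - e2)) (cell_row y) <= cell_col y)%N
      = (col (cell_col y) - ebit (cell_col y) <= cell_row y)%N.
    by rewrite leqNgt lt_nu -leqNgt.
  apply/eqP/forallP => [[k0 k1 k2] y|h].
    rewrite nuE botP //.
    have -> : bot t (cell_col y) = ebit (cell_col y).
      move: (colP y); case: (cell_col y) => [|[|[|j]]] //.
      by rewrite /col /= nth_nil.
    have := colP y; have := ebit_col (cell_col y).
    by case: (ebit _) => /=; lia.
  suff H j : bot t j = ebit j by rewrite /key !H.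
  rewrite /bot; apply/existsP/idP => [[y /andP[/eqP cy tyn]]|ej].
    have := h y; rewrite tyn nuE cy; have := colP y; rewrite cy.
    by case: (ebit j) => //=; lia.
  have [y [ry cy]] : exists y : cell mu, cell_row y = (col j).-1 /\ cell_col y = j.
    by apply: mk; have := ebit_col j; rewrite ej; case: (col j).
  exists y; rewrite cy eqxx (eqP (h y)) nuE ry cy ej.
  by rewrite /= subn1.
(* The row length [nth 0 mu i] itself serves as column index, which makes it smaller than itself. *)
- move=> i; rewrite leqNgt lt_nu; apply/negP => h.
  have : (nth 0 mu i < nth 0 mu i)%N by rewrite lt_mu; move: h; lia.
  by rewrite ltnn.
- move=> i; rewrite leqNgt lt_mu; apply/negP => h.
  set J := nth _ _ _ in h; have : (J < J)%N.
    by rewrite lt_nu; move: h; case: (ebit J) => /=; lia.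
  by rewrite ltnn.
Qed.

End Branching.

Lemma col_shape2 C D : col_shape (C + D) C 0 = nseq C 2%N ++ nseq D 1%N.
Proof.
apply: (@eq_from_nth _ 0%N); first by rewrite size_mkseq size_cat !size_nseq.
move=> i; rewrite size_mkseq => ilt; rewrite nth_mkseq // nth_cat size_nseq !nth_nseq.
by case: (ltnP i C) => iC //=; case: ltnP => //; lia.
Qed.

Lemma col_shape3 C D :
  col_shape (C + D).+1 C.+1 1 = 3%N :: nseq C 2%N ++ nseq D 1%N.
Proof.
apply: (@eq_from_nth _ 0%N).
  by rewrite size_mkseq /= size_cat !size_nseq.
move=> i; rewrite size_mkseq => ilt; rewrite nth_mkseq //.
case: i ilt => //= i; rewrite nth_cat size_nseq !nth_nseq !ltnS => ilt.
by case: (ltnP i C) => iC //=; case: ltnP => //; lia.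
Qed.

Lemma big_bool3 (R : nmodType) (F : bool * bool * bool -> R) :
  \sum_e F e = F (true, true, true) + F (true, true, false)
     + (F (true, false, true) + F (true, false, false))
     + (F (false, true, true) + F (false, true, false)
       + (F (false, false, true) + F (false, false, false))).
Proof.
rewrite (eq_bigr (fun e => F (e.1, e.2))); last by case.
rewrite -(pair_bigA _ (fun e d => F (e, d))) /=.
rewrite (eq_bigr (fun e : bool * bool => \sum_d F (e.1, e.2, d))); last by case.
by rewrite -(pair_bigA _ (fun a b => \sum_d F (a, b, d))) /= !big_bool.
Qed.

(** * Shapes (2^C, 1^D) and (3, 2^C, 1^D) *)

Section TwoThreeColumns.

Variables (N : nat) (R : comNzRingType) (x : 'I_N -> R).

Definition schur2 C D n := tableaux x (nseq C 2%N ++ nseq D 1%N) n.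
Definition schur3 C D n := tableaux x (3%N :: nseq C 2%N ++ nseq D 1%N) n.

Lemma schur2E C D n : schur2 C D n = tableaux x (col_shape (C + D) C 0) n.
Proof. by rewrite col_shape2. Qed.

Lemma schur3E C D n : schur3 C D n = tableaux x (col_shape (C + D).+1 C.+1 1) n.
Proof. by rewrite col_shape3. Qed.

Ltac decide_ifs := repeat
  match goal with |- context [if ?c then _ else _] =>
    first [rewrite (_ : c = true); last by lia | rewrite (_ : c = false); last by lia]
  end.

Ltac expand_branching :=
  rewrite ?schur2E ?schur3E tableaux_branching; last (by lia);
  rewrite big_mkcond big_bool3 /= ?(addSn, addnS, addn0, add0n) ?(subSS, subn0, subn1) /=;
  decide_ifs; rewrite ?(addSn, addnS, addn0, add0n) /=.

Lemma schur2_branching C D (n : 'I_N) :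
  schur2 C D n.+1 = schur2 C D n
    + x n * (if D is D'.+1 then schur2 C D' n else 0)
    + x n * (if C is C'.+1 then schur2 C' D.+1 n else 0)
    + x n ^+ 2 * (if C is C'.+1 then schur2 C' D n else 0).
Proof.
case: C D => [|C] [|D]; expand_branching; ring.
Qed.

(** The first four terms keep the third cell of the top row. The last bracket removes it and is the
    branching of (2^(C+1), 1^D). *)
Lemma schur3_branching C D (n : 'I_N) :
  schur3 C D n.+1 = schur3 C D n
    + x n * (if D is D'.+1 then schur3 C D' n else 0)
    + x n * (if C is C'.+1 then schur3 C' D.+1 n else 0)
    + x n ^+ 2 * (if C is C'.+1 then schur3 C' D n else 0)
    + x n * (schur2 C.+1 D n + x n * (if D is D'.+1 then schur2 C.+1 D' n else 0)
             + x n * schur2 C D.+1 n + x n ^+ 2 * schur2 C D n).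
Proof.
case: C D => [|C] [|D]; expand_branching; ring.
Qed.

Lemma tableaux0 mu : (0 < sumn mu)%N -> tableaux x mu 0 = 0.
Proof.
rewrite -card_cell => /card_gt0P[y _].
by rewrite /tableaux big_pred0 // => t; apply/negP => /andP[_ /forallP/(_ y)].
Qed.

Lemma tableaux_nil n : tableaux x [::] n = 1.
Proof.
have f0 : cell [::] -> 'I_N by case=> -[].
rewrite /tableaux (big_pred1 (finfun f0)); first by rewrite big1 // => -[[]].
move=> f /=; have -> : f = finfun f0 by apply/ffunP => -[[]].
by rewrite eqxx; apply/andP; split; apply/forallP => -[[]].
Qed.

Definition low n : {set 'I_N} := [set i : 'I_N | (i < n)%N].

Lemma low0 : low 0 = set0.
Proof. by apply/setP => i; rewrite !inE. Qed.

Lemma lowS (n : 'I_N) : low n.+1 = n |: low n.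
Proof. by apply/setP => i; rewrite !inE ltnS leq_eqVlt. Qed.

Lemma low_notin (n : 'I_N) : n \notin low n.
Proof. by rewrite inE ltnn. Qed.

Lemma psum_lowS (n : 'I_N) : psum x (low n.+1) = x n + psum x (low n).
Proof. by rewrite lowS /psum big_setU1 //= low_notin. Qed.

(** Induction on the number of variables in which the step has the new variable available as an
    index in ['I_N]. *)
Lemma low_ind (P : nat -> Prop) :
  P 0%N -> (forall n : 'I_N, P n -> P n.+1) -> forall n, (n <= N)%N -> P n.
Proof.
move=> P0 PS; elim=> // n IHn ltn.
exact: (PS (Ordinal ltn) (IHn (ltnW ltn))).
Qed.

(** Both sides vanish without variables and obey the same branching rule. The added cell goes to the
    first column, the second column or the top row. *)
Lemma schur2_pieri C D n : (n <= N)%N ->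
  psum x (low n) * schur2 C D n = schur2 C D.+1 n
    + (if D is D'.+1 then schur2 C.+1 D' n else 0)
    + (if C is C'.+1 then schur3 C' D n else 0).
Proof.
move=> nN; move: n nN C D; apply: low_ind => [|n IHn] C D.
  rewrite low0 /psum big_set0 mul0r.
  rewrite [schur2 C _ _]tableaux0 ?sumn_cat ?sumn_nseq ?mul1n ?addnS //.
  case: C D => [|C] [|D]; rewrite ?addr0 ?add0r //; 
    rewrite /schur2 /schur3 ?tableaux0 ?addr0 //= ?sumn_cat ?sumn_nseq; lia.
rewrite psum_lowS schur2_branching.
set A := schur2 C D n; set B := if D is _.+1 then _ else _.
set E := if C is _.+1 then schur2 _ D.+1 _ else _;
set F := if C is _.+1 then schur2 _ D _ else _.
(* Separating the new variable from the old power sum makes the induction hypothesis applicable to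
   each of the four shapes. *)
rewrite (_ : (_ + _) * _ = x n * (A + x n * B + x n * E + x n ^+ 2 * F)
  + (psum x (low n) * A + x n * (psum x (low n) * B) + x n * (psum x (low n) * E)
     + x n ^+ 2 * (psum x (low n) * F))); last by ring.
rewrite {}/A {}/B {}/E {}/F.
by case: C D => [|[|C]] [|[|D]]; rewrite ?mulr0 !IHn !schur2_branching ?schur3_branching; ring.
Qed.

(** The coefficient of the Schur function of (2^C, 1^(2(a-C)+b)) for K_(2^a, 1^b). The falling
    factorial expresses a!/(a-C)! without division. *)
Definition twos_coef a b C : int := (a ^_ C)%:R * fdiff (a - C) (a - C + b).

Lemma twos_coefSS a b C : twos_coef a.+1 b C.+1 = a.+1%:R * twos_coef a b C.
Proof. by rewrite /twos_coef ffactSS subSS natrM mulrA. Qed.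

Lemma twos_coefnn a b : twos_coef a b a = (a`! * b`!)%:R.
Proof. by rewrite /twos_coef ffactnn subnn natrM. Qed.

Lemma twos_coefnnS a b : (twos_coef a b.+1 a)%:~R = b.+1%:R * (twos_coef a b a)%:~R :> R.
Proof. by rewrite !twos_coefnn factS mulnCA !rmorph_nat natrM. Qed.

(** This compares the coefficients of the first power of the new variable: on the left a cell leaves
    the first column of the C-th shape or the second column of the next one. *)
Lemma twos_coefD a b C : (C <= a)%N ->
  twos_coef a.+1 b C + twos_coef a.+1 b C.+1
    = (2 * a.+1)%:R * twos_coef a b.+1 C + b%:R * twos_coef a.+1 b.-1 C.
Proof.
move=> Ca; rewrite natrM -mulrA -twos_coefSS /twos_coef subSS subSn // ffactnSr subSn //.
move: (a - C)%N => m; rewrite natrM addnS addSn.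
suff e : fdiff m.+1 (m + b).+1 + m.+1%:R * fdiff m (m + b)
    = 2%:R * m.+1%:R * fdiff m (m + b).+1 + b%:R * fdiff m.+1 (m.+1 + b.-1).
  transitivity ((a.+1 ^_ C)%:R * (fdiff m.+1 (m + b).+1 + m.+1%:R * fdiff m (m + b))).
    by ring.
  by rewrite e; ring.
(* At b = 0 the term with [b.-1] disappears and [fdiff_diag] is the required relation; otherwise
   [fdiffSr] is. *)
case: b => [|b]; first by rewrite addn0 fdiff_diag mul0r; ring.
rewrite [b.+1.-1]/= addnS addSn (fdiffSr m.+1) [m.+1.-1]/=.
have -> : fdiff m (m + b).+2 = fdiff m.+1 (m + b).+1 + fdiff m (m + b).+1.
  by rewrite fdiffS subrK.
have -> : ((m + b).+2 + m.+1 = 2 * m.+1 + b.+1)%N by lia.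
by rewrite natrD natrM; ring.
Qed.

Lemma colorings2_low0 a b : colorings2 x a b (low 0) = ((a == 0) && (b == 0))%:R.
Proof.
rewrite low0; case: a => [|a]; last by rewrite colorings2S place2E big_set0.
by case: b => //= b; rewrite place1E big_set0.
Qed.

(** Induction on the number of colors, matching [colorings2U1] with [schur2_branching] power by
    power of the new variable. *)
Lemma colorings2_schur a b n : (n <= N)%N ->
  colorings2 x a b (low n) =
    \sum_(C < a.+1) (twos_coef a b C)%:~R * schur2 C (2 * (a - C) + b) n.
Proof.
move=> nN; move: n nN a b; apply: low_ind => [|n IHn] a b.
  rewrite colorings2_low0; case: (posnP (a + b)) => [|ab].
    case: a b => [|a] [|b] // _; rewrite big_ord1 /schur2 tableaux_nil mulr1.
    by rewrite /twos_coef ffactn0 mul1r.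
  rewrite big1 => [|C _]; last first.
    by rewrite /schur2 tableaux0 ?mulr0 // sumn_cat !sumn_nseq; have := ltn_ord C; lia.
  by case: a b ab => [|a] [|b].
rewrite lowS colorings2U1 ?low_notin // !IHn -addrA; set rhs := RHS.
have -> : rhs = \sum_(C < a.+1) (twos_coef a b C)%:~R * schur2 C (2 * (a - C) + b) n
   + (x n * (\sum_(C < a.+1) (twos_coef a b C)%:~R *
          (if (2 * (a - C) + b)%N is D.+1 then schur2 C D n else 0)
        + \sum_(C < a.+1) (twos_coef a b C)%:~R *
          (if C : nat is C'.+1 then schur2 C' (2 * (a - C) + b).+1 n else 0))
   + x n ^+ 2 * \sum_(C < a.+1) (twos_coef a b C)%:~R *
          (if C : nat is C'.+1 then schur2 C' (2 * (a - C) + b) n else 0)).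
  rewrite /rhs mulrDr !mulr_sumr -!big_split /=; apply: eq_bigr => C _.
  rewrite schur2_branching; move: (2 * (a - C) + b)%N => D; move: (nat_of_ord C) => C1.
  by case: C1 D => [|C1] [|D]; ring.
congr (_ + (_ * _ + _ * _)).
  case: a {rhs} => [|a].
    rewrite muln0 mul0r add0r !big_ord1 /= mulr0 addr0.
    case: b => [|b] /=; first by rewrite mul0r mulr0.
    by rewrite twos_coefnnS mulrA.
  (* Removing the top term of the first sum and the zero term at C = 0 of the second aligns index C
     with C + 1, as in [twos_coefD]. *)
  rewrite [X in _ = X + _]big_ord_recr [X in _ = _ + X]big_ord_recl /= mulr0 add0r.
  rewrite [X in _ + _ * X]big_ord_recr /= mulrDr !addrA [RHS]addrAC; congr (_ + _).
    rewrite !mulr_sumr -!big_split /=; apply: eq_bigr => C _.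
    have Ca : (C <= a)%N by rewrite -ltnS.
    have -> : (2 * (a.+1 - C) + b = (2 * (a - C) + b.+1).+1)%N by lia.
    rewrite subSS -addnS -mulrDl -intrD twos_coefD // intrD !intrM !mulrDl -!mulrA.
    rewrite !rmorph_nat; congr (_ + _).
    case: b => [|b]; first by rewrite !mul0r.
    by congr (_ * (_ * (_ * schur2 _ _ _))); lia.
  rewrite subnn muln0 !add0n; case: b => [|b]; first by rewrite mul0r mulr0.
  by rewrite /= twos_coefnnS mulrA.
case: a {rhs} => [|a]; first by rewrite mul0r big_ord1 mulr0.
rewrite [RHS]big_ord_recl mulr0 add0r mulr_sumr; apply: eq_bigr => C _.
by rewrite /= twos_coefSS intrM mulrA subSS rmorph_nat.
Qed.

End TwoThreeColumns.

(** * Uniqueness of Schur expansions *)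

Lemma is_part_nth mu i : is_part mu -> (nth 0 mu i.+1 <= nth 0 mu i)%N.
Proof.
case/andP=> smu _; case: (ltnP i.+1 (size mu)) => isz; last by rewrite nth_default.
have tg : transitive geq by move=> a b c /= ba cb; apply: leq_trans cb ba.
by apply: (sorted_ltn_nth tg 0%N smu); rewrite ?inE // ltnW.
Qed.

Lemma is_part_inj mu nu : is_part mu -> is_part nu ->
  (forall i, nth 0 mu i = nth 0 nu i)%N -> mu = nu.
Proof.
move=> /andP[_ /allP pmu] /andP[_ /allP pnu] e.
have sz s t : {in t, forall k, 0 < k}%N -> (forall i, nth 0 s i = nth 0 t i)%N ->
    (size t <= size s)%N.
  move=> pt est; rewrite leqNgt; apply/negP => lt.
  have := pt _ (mem_nth 0%N lt); by rewrite -est nth_default.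
apply: (@eq_from_nth _ 0%N) => [|i _]; last exact: e.
by apply/eqP; rewrite eqn_leq !sz // => i; rewrite e.
Qed.

Lemma row_le_entry mu N (t : {ffun cell mu -> 'I_N}) y :
  is_part mu -> semistandard t -> (cell_row y <= t y)%N.
Proof.
move=> pmu /semistandardP[_ ss].
move: {2}(cell_row y) (erefl (cell_row y)) => r.
elim: r y => [|r IHr] y ry; rewrite ?ry //.
have h : (cell_col y < nth 0 mu r)%N.
  by apply: leq_trans (ltn_cell y) _; rewrite ry is_part_nth.
apply: leq_ltn_trans (IHr (mkcell h) (erefl _)) _.
by apply: ss => //=; rewrite ry.
Qed.

(** The statistic n(mu), the sum of i mu_i with rows counted from 0. It replaces the dominance order
    in the triangularity argument. *)
Definition rowsum mu : nat := \sum_(y : cell mu) cell_row y.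

Section Content.

Variable N : nat.

Definition content mu (t : {ffun cell mu -> 'I_N}) : 'X_{1..N} :=
  (\sum_(y : cell mu) U_(t y))%MM.

Lemma contentE mu (t : {ffun cell mu -> 'I_N}) i :
  content t i = #|[set y | t y == i]|.
Proof.
rewrite /content mnm_sumE cardE -sum1_size big_enum [RHS]big_mkcond /=.
by apply: eq_bigr => y _; rewrite mnm1E inE; case: eqP.
Qed.

(** These coefficients are the Kostka numbers. *)
Lemma mcoeff_schur mu (m : 'X_{1..N}) :
  (schur mu N)@_m
    = #|[set t : {ffun cell mu -> 'I_N} | semistandard t && (content t == m)]|%:R.
Proof.
rewrite /schur raddf_sum cardE -sum1_size big_enum natr_sum /=.
rewrite [LHS]big_mkcond [RHS]big_mkcond; apply: eq_bigr => t _.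
rewrite inE; case: ifP => //= _.
have -> : \prod_y 'X_(t y) = 'X_[content t] :> {mpoly int[N]}.
  by rewrite /content (big_morph _ (mpolyXD int) (mpolyX0 N int)).
by rewrite mcoeffX; case: eqP.
Qed.

Lemma sum_content mu (t : {ffun cell mu -> 'I_N}) :
  (\sum_(y : cell mu) t y = \sum_(i < N) i * content t i)%N.
Proof.
rewrite (partition_big t predT) //=; apply: eq_bigr => i _.
rewrite (eq_bigr (fun=> i : nat)) => [|y /eqP -> //].
rewrite sum_nat_const mulnC contentE; congr (_ * _)%N.
by apply: eq_card => y; rewrite !inE.
Qed.

End Content.

Lemma card_row mu i : #|[set y : cell mu | cell_row y == i]| = nth 0%N mu i.
Proof.
case: (ltnP i (size mu)) => isz; last first.
  rewrite nth_default //; apply/eqP; rewrite cards_eq0; apply/eqP/setP => y.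
  rewrite !inE; apply/negbTE; rewrite neq_ltn; apply/orP; left.
  exact: leq_trans (ltn_ord (tag y)) isz.
pose f (j : 'I_(nth 0%N mu i)) : cell mu := mkcell (ltn_ord j).
have finj : injective f by move=> j k e; apply/val_inj/(congr1 (@cell_col _) e).
rewrite -[RHS]card_ord -(card_codom finj); apply: eq_card => y; rewrite inE.
apply/eqP/codomP => [ry|[j ->] //].
have h : (cell_col y < nth 0 mu i)%N by rewrite -ry ltn_cell.
by exists (Ordinal h); apply: cell_inj.
Qed.

(** The tableau whose i-th row is constantly i shows that the diagonal Kostka numbers are
    nonzero. *)
Lemma schur_content_refl mu : exists t : {ffun cell mu -> 'I_(size mu)},
  semistandard t /\ content t = [multinom nth 0%N mu i | i < size mu].
Proof.
exists [ffun y => tag y]; split.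
  by apply/semistandardP; split=> y z; rewrite !ffunE // => e _; apply: eq_leq e.
apply/mnmP => i; rewrite contentE mnmE -card_row; apply: eq_card => y.
by rewrite !inE ffunE.
Qed.

(** The sum of the entries depends only on the content, hence equals [rowsum mu], while each entry
    is at least its row index. Equality forces every entry to be its row index, and the content then
    gives the row lengths. *)
Lemma rowsum_content la mu (t : {ffun cell la -> 'I_(size mu)}) :
  is_part la -> is_part mu -> semistandard t ->
  content t = [multinom nth 0%N mu i | i < size mu] ->
  (rowsum la < rowsum mu)%N \/ la = mu.
Proof.
move=> pla pmu sst ct.
have le y : (cell_row y <= t y)%N by apply: row_le_entry.
have -> : rowsum mu = (\sum_(y : cell la) t y)%N.
  have [t0 [_ ct0]] := schur_content_refl mu.
  rewrite sum_content ct.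
  rewrite /rowsum (partition_big (fun y : cell mu => tag y) predT) //=.
  apply: eq_bigr => i _; rewrite (eq_bigr (fun=> i : nat)) => [|y /eqP <- //].
  rewrite sum_nat_const mulnC mnmE -card_row; congr (_ * _)%N.
  by apply: eq_card => y; rewrite !inE.
have : (rowsum la <= \sum_(y : cell la) t y)%N by apply: leq_sum => y _.
rewrite leq_eqVlt.
case/orP=> [/eqP e|]; [right|by left].
have {}e y : t y = cell_row y :> nat.
  have : (\sum_(z : cell la) (t z - cell_row z) = 0)%N.
    by rewrite sumnB // -e subnn.
  move/eqP; rewrite sum_nat_eq0 => /forallP/(_ y)/implyP/(_ isT).
  by rewrite subn_eq0 => h; apply/eqP; rewrite eqn_leq h le.
apply: is_part_inj => // i; rewrite -card_row.
case: (ltnP i (size mu)) => isz.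
  have /mnmP/(_ (Ordinal isz)) := ct; rewrite contentE mnmE => <-.
  by apply: eq_card => y; rewrite !inE -val_eqE /= e.
rewrite nth_default //; apply/eqP; rewrite cards_eq0; apply/eqP/setP => y.
by rewrite !inE -e; apply/negbTE; rewrite neq_ltn (leq_trans _ isz).
Qed.

(* Entries of a tableau are at least their row index, so x^mu occurs in s_la only if
   rowsum la < rowsum mu or la = mu: the Schur functions are unitriangular. *)
Lemma schur_free (s : seq (seq nat)) (g : seq nat -> int) :
    uniq s -> all is_part s ->
    (forall N, \sum_(mu <- s) g mu *: schur mu N = 0) ->
  {in s, forall mu, g mu = 0}.
Proof.
move=> us /allP ps eq0 mu; move: {2}(rowsum mu).+1 (ltnSn (rowsum mu)) => k.
elim: k mu => // k IHk mu lek mus.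
have /(congr1 (mcoeff [multinom nth 0%N mu i | i < size mu])) := eq0 (size mu).
rewrite raddf_sum mcoeff0 (bigD1_seq mu) //= big1_seq ?addr0 => [|la /andP[lamu las]].
  rewrite mcoeffZ mcoeff_schur => /eqP; rewrite mulf_eq0 => /orP[/eqP //|].
  have [t [sst ct]] := schur_content_refl mu.
  rewrite pnatr_eq0 cards_eq0 => /eqP/setP/(_ t).
  by rewrite !inE sst ct eqxx.
rewrite mcoeffZ mcoeff_schur.
case: (set_0Vmem [set t : {ffun cell la -> 'I_(size mu)} |
   semistandard t && (content t == [multinom nth 0%N mu i | i < size mu])]).
  by move=> ->; rewrite cards0 mulr0.
case=> t; rewrite inE => /andP[sst /eqP ct].
case: (rowsum_content (ps _ las) (ps _ mus) sst ct) => [lt|e].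
  by rewrite IHk ?mul0r //; apply: leq_trans lt _.
by rewrite e eqxx in lamu.
Qed.

Lemma schur_expansion_uniq f c1 c2 mu :
  schur_expansion f c1 -> schur_expansion f c2 -> c1 mu = c2 mu.
Proof.
case=> p1 e1 [p2 e2]; pose s := undup (finsupp c1 ++ finsupp c2).
have sumE (c : {fsfun seq nat -> int with 0}) N : {subset finsupp c <= s} ->
    \sum_(la <- finsupp c) c la *: schur la N = \sum_(la <- s) c la *: schur la N.
  move=> cs; rewrite [RHS](bigID (fun la => la \in finsupp c)) /=.
  rewrite [X in _ = _ + X]big1 ?addr0 => [|la /fsfun_dflt ->]; last by rewrite scale0r.
  rewrite -[RHS]big_filter; apply: perm_big; apply: uniq_perm; rewrite ?fset_uniq //.
    by rewrite filter_uniq ?undup_uniq.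
  by move=> la; rewrite mem_filter andb_idr // => /cs.
have in1 : {subset finsupp c1 <= s} by move=> la h; rewrite mem_undup mem_cat h.
have in2 : {subset finsupp c2 <= s} by move=> la h; rewrite mem_undup mem_cat h orbT.
apply/eqP; rewrite -subr_eq0; apply/eqP.
case: (boolP (mu \in s)) => [mus|]; last first.
  by rewrite mem_undup mem_cat negb_or => /andP[/fsfun_dflt -> /fsfun_dflt ->]; rewrite subrr.
apply: (@schur_free s (fun la => c1 la - c2 la)) => //; first exact: undup_uniq.
  by apply/allP => la; rewrite mem_undup mem_cat => /orP[/p1|/p2].
move=> N; rewrite (eq_bigr (fun la => c1 la *: schur la N - c2 la *: schur la N)).
  by rewrite sumrB -!sumE // -e1 -e2 subrr.
by move=> la _; rewrite scalerBl.
Qed.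

(** Collecting equal shapes in l gives a finitely supported expansion; by uniqueness the one chosen
    by [epsilon] agrees with it. *)
Lemma schur_coefE f (l : seq (seq nat * int)) mu :
    all (fun p => is_part p.1) l ->
    (forall N, f N = \sum_(p <- l) p.2 *: schur p.1 N) ->
  schur_coef f mu = \sum_(p <- l | p.1 == mu) p.2.
Proof.
move=> /allP pl fE; pose F := undup (unzip1 l).
pose g la := \sum_(p <- l | p.1 == la) p.2.
pose c : {fsfun seq nat -> int with 0} := [fsfun la in [fset la | la in F]%fset => g la].
have cE la : c la = g la.
  rewrite /c fsfunE !inE /= mem_undup; case: ifP => // h; rewrite /g big1_seq //.
  by move=> p /andP[/eqP e pin]; rewrite -e (map_f fst pin) in h.
have gN la : la \notin F -> g la = 0.
  move=> h; rewrite /g big1_seq // => p /andP[/eqP e pin].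
  by move: h; rewrite mem_undup -e (map_f fst pin).
have cexp : schur_expansion f c.
  split=> [la|N].
    rewrite mem_finsupp cE => h; case: (boolP (la \in F)) => [|/gN e].
      by rewrite mem_undup => /mapP[p /pl ? ->].
    by rewrite e eqxx in h.
  transitivity (\sum_(la <- F) c la *: schur la N).
    rewrite fE; under [RHS]eq_bigr => la _ do rewrite cE /g scaler_suml.
    rewrite [RHS](exchange_big_dep predT) //= big_seq [RHS]big_seq.
    apply: eq_bigr => p pin; rewrite -big_filter.
    rewrite (_ : [seq _ <- _ | _] = [:: p.1]) ?big_seq1 //.
    rewrite (eq_filter (a2 := pred1 p.1)) => [|la]; last by rewrite /= eq_sym.
    by rewrite filter_pred1_uniq ?undup_uniq // mem_undup map_f.
  rewrite (bigID (fun la => la \in finsupp c)) /=.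
  rewrite [X in _ + X]big1 ?addr0 => [|la /fsfun_dflt ->]; last by rewrite scale0r.
  rewrite -big_filter; apply: perm_big; apply: uniq_perm; rewrite ?fset_uniq //.
    by rewrite filter_uniq ?undup_uniq.
  move=> la; rewrite mem_filter andb_idr // mem_finsupp cE => h.
  by apply/negPn/negP => /gN e; rewrite e eqxx in h.
rewrite -/(g mu) -cE.
exact: schur_expansion_uniq (epsilon_spec _ _ (ex_intro _ c cexp)) cexp.
Qed.

(** * Schur expansions of the chromatic symmetric functions *)

(** The coefficient of the Schur function of (2^C, 1^(2(beta+1-C)+1)) for K_(3, 2^beta). The case C
    = 0 is separate because no Pieri term then adds a cell to the second column. *)
Definition three_coef beta C : int :=
  if C is C'.+1
  then (beta ^_ C')%:R * beta.+2%:R * fdiff (beta - C') (beta - C').+1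
  else Nsp3 beta.

Lemma three_coef0E beta :
  beta.+1%:R * three_coef beta 0 = twos_coef beta.+1 0 0 + beta%:R * twos_coef beta.+1 1 0.
Proof.
by rewrite Nsp3E /twos_coef !ffactn0 !mul1r !subn0 addn0 addn1.
Qed.

Lemma three_coefSE beta C : (C <= beta)%N ->
  beta.+1%:R * three_coef beta C.+1 =
  twos_coef beta.+1 0 C.+1 + twos_coef beta.+1 0 C + beta%:R * twos_coef beta.+1 1 C.+1.
Proof.
move=> Cb; rewrite !twos_coefSS /twos_coef /three_coef addn0 addn1.
rewrite addn0 subSn // fdiff_diag -(addn2 beta) natrD.
have -> : (beta.+1 ^_ C)%:R * ((beta - C).+1%:R * (2%:R * fdiff (beta - C) (beta - C).+1
              - fdiff (beta - C) (beta - C)))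
   = beta.+1%:R * (beta ^_ C)%:R * (2%:R * fdiff (beta - C) (beta - C).+1
              - fdiff (beta - C) (beta - C)) :> int.
  by rewrite mulrA -!natrM -subSn // -ffactnSr ffactSS.
by ring.
Qed.

Section Expansion.

Variables (N : nat) (R : comNzRingType) (x : 'I_N -> R).

(** The factor beta + 1 comes from [colorings3_psum] and remains because R is an arbitrary ring; it
    is cancelled later over integer polynomials. *)
Lemma colorings3_schur beta n : (n <= N)%N ->
  beta.+1%:R * colorings3 x beta (low N n) =
  beta.+1%:R *
    (\sum_(C < beta.+2) (three_coef beta C)%:~R * schur2 x C (2 * (beta.+1 - C) + 1) n
     + \sum_(C < beta.+1) (twos_coef beta 0 C)%:~R * schur3 x C (2 * (beta - C)) n).
Proof.
move=> nN; rewrite colorings3_psum !colorings2_schur //.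
set D := fun C => (2 * (beta.+1 - C) + 0)%N.
have -> : psum x (low N n) *
    (\sum_(C < beta.+2) (twos_coef beta.+1 0 C)%:~R * schur2 x C (D C) n)
  = \sum_(C < beta.+2) (twos_coef beta.+1 0 C)%:~R * schur2 x C (D C).+1 n
  + \sum_(C < beta.+2) (twos_coef beta.+1 0 C)%:~R *
      (if D C is D'.+1 then schur2 x C.+1 D' n else 0)
  + \sum_(C < beta.+2) (twos_coef beta.+1 0 C)%:~R *
      (if C : nat is C'.+1 then schur3 x C' (D C) n else 0).
  rewrite mulr_sumr -!big_split /=; apply: eq_bigr => C _.
  by rewrite mulrCA schur2_pieri // !mulrDr.
rewrite [X in _ + _ + X]big_ord_recl mulr0 add0r mulrDr addrAC; congr (_ + _); last first.
  rewrite mulr_sumr; apply: eq_bigr => C _.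
  by rewrite /= twos_coefSS intrM rmorph_nat mulrA /D addn0 subSS.
(* For C = beta + 1 the shape has no row of length 1 to lengthen, so this Pieri term is 0. *)
rewrite [X in _ + X + _]big_ord_recr [X in _ + (_ + X) + _](_ : _ = 0); last first.
  by rewrite /D subnn muln0 addn0 /= mulr0.
rewrite addr0.
(* The terms at C = 0 are split off; the rest is shifted by one to meet the second-column Pieri
   terms. *)
rewrite [X in X + _ + _]big_ord_recl [X in _ + _ * X]big_ord_recl [X in _ = _ * X]big_ord_recl.
have split6 (u A B v E k : R) : u + A + B + k * (v + E) = u + k * v + (A + B + k * E).
  by ring.
rewrite split6 mulrDr; congr (_ + _).
  have -> : (D (ord0 : 'I_beta.+2)).+1 = (2 * (beta.+1 - (ord0 : 'I_beta.+2)) + 1)%N.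
    by rewrite /D addn0 addn1.
  rewrite !mulrA -(rmorph_nat (intmul 1) beta.+1) -intrM three_coef0E intrD intrM.
  by rewrite rmorph_nat mulrDl.
rewrite !mulr_sumr -!big_split; apply: eq_bigr => C _.
have Cb : (C <= beta)%N by rewrite -ltnS.
have D1 : D (widen_ord (leqnSn beta.+1) C) = (2 * (beta - C) + 1).+1.
  by rewrite /D /=; lia.
have D2 : (D (lift ord0 C)).+1 = (2 * (beta - C) + 1)%N.
  by rewrite /D /= subSS; lia.
rewrite D1 D2 /= subSS.
rewrite [RHS]mulrA -(rmorph_nat (intmul 1) beta.+1) -intrM three_coefSE // !intrD intrM.
by rewrite rmorph_nat; ring.
Qed.

Lemma low_full : low N N = setT.
Proof. by apply/setP => i; rewrite !inE ltn_ord. Qed.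

End Expansion.

Lemma tableaux_schur mu N : tableaux (fun i : 'I_N => 'X_i) mu N = schur mu N.
Proof.
apply: eq_bigl => t; rewrite (_ : [forall y, _]) ?andbT //.
by apply/forallP => y; apply: ltn_ord.
Qed.

Lemma mpoly_natr_neq0 N n : n.+1%:R != 0 :> {mpoly int[N]}.
Proof. by rewrite -mpolyC_nat mpolyC_eq0 pnatr_eq0. Qed.

Lemma mulz_mpoly N (c : int) (p : {mpoly int[N]}) : c%:~R * p = c *: p.
Proof. by rewrite mulrzl -[in RHS](intz c) scaler_int. Qed.

Lemma XK_twos_schur beta N :
  XK (nseq beta 2%N) N = \sum_(C < beta.+1)
    twos_coef beta 0 C *: schur (nseq C 2%N ++ nseq (2 * (beta - C)) 1%N) N.
Proof.
rewrite -[nseq beta 2%N]cats0 (XK_twos_ones beta 0) -(low_full N) colorings2_schur //.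
by apply: eq_bigr => C _; rewrite addn0 /schur2 tableaux_schur mulz_mpoly.
Qed.

Lemma XK_three_twos_schur beta N :
  XK (3%N :: nseq beta 2%N) N =
    \sum_(C < beta.+2)
      three_coef beta C *: schur (nseq C 2%N ++ nseq (2 * (beta.+1 - C) + 1) 1%N) N
  + \sum_(C < beta.+1)
      twos_coef beta 0 C *: schur (3%N :: nseq C 2%N ++ nseq (2 * (beta - C)) 1%N) N.
Proof.
rewrite XK_three_twos -(low_full N); apply: (mulfI (mpoly_natr_neq0 N beta)).
rewrite colorings3_schur //; congr (_ * (_ + _)); apply: eq_bigr => C _.
  by rewrite /schur2 tableaux_schur mulz_mpoly.
by rewrite /schur3 tableaux_schur mulz_mpoly.
Qed.

(** * Reading off the coefficients *)

Lemma path_twos_ones k C D : (1 < k)%N ->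
  path geq k (nseq C 2%N ++ nseq D 1%N).
Proof.
have ones j : (0 < j)%N -> path geq j (nseq D 1%N).
  by elim: D j => //= D IHD j j0; rewrite j0 IHD.
by elim: C k => [|C IHC] k k1 /=; rewrite ?k1 ?ones ?IHC // ltnW.
Qed.

Lemma is_part_twos_ones C D : is_part (nseq C 2%N ++ nseq D 1%N).
Proof.
rewrite /is_part (path_sorted (path_twos_ones C D (ltnSn 1))) all_cat.
by rewrite !all_nseq !orbT.
Qed.

Lemma is_part_three_twos_ones C D : is_part (3%N :: nseq C 2%N ++ nseq D 1%N).
Proof.
by rewrite /is_part /= path_twos_ones //; have /andP[_] := is_part_twos_ones C D.
Qed.

Lemma twos_ones_eq C D C' D' :
  (nseq C 2%N ++ nseq D 1%N == nseq C' 2%N ++ nseq D' 1%N) = (C == C') && (D == D').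
Proof.
apply/eqP/andP => [e|[/eqP -> /eqP ->] //].
split; [have /eqP := congr1 (count_mem 2%N) e | have /eqP := congr1 (count_mem 1%N) e];
  by rewrite !count_cat !count_nseq /= !mul1n !mul0n ?addn0 ?add0n.
Qed.

Lemma three_neq_twos_ones s C D : (3%N :: s == nseq C 2%N ++ nseq D 1%N) = false.
Proof.
by apply/eqP => /(congr1 (count_mem 3%N)); rewrite /= count_cat !count_nseq /= !mul0n.
Qed.

Lemma schur_coef_twos beta mu :
  schur_coef (XK (nseq beta 2%N)) mu =
  \sum_(C < beta.+1 | nseq C 2%N ++ nseq (2 * (beta - C)) 1%N == mu) twos_coef beta 0 C.
Proof.
pose l := [seq (nseq C 2%N ++ nseq (2 * (beta - C)) 1%N, twos_coef beta 0 C)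
             | C : 'I_beta.+1 <- index_enum 'I_beta.+1].
rewrite (@schur_coefE _ l).
- by rewrite big_map.
- by rewrite all_map; apply/allP => C _; apply: is_part_twos_ones.
- by move=> N; rewrite XK_twos_schur big_map.
Qed.

Lemma schur_coef_three_twos beta mu :
  schur_coef (XK (3%N :: nseq beta 2%N)) mu =
  \sum_(C < beta.+2 | nseq C 2%N ++ nseq (2 * (beta.+1 - C) + 1) 1%N == mu)
     three_coef beta C
  + \sum_(C < beta.+1 | 3%N :: nseq C 2%N ++ nseq (2 * (beta - C)) 1%N == mu)
     twos_coef beta 0 C.
Proof.
pose l := [seq (nseq C 2%N ++ nseq (2 * (beta.+1 - C) + 1) 1%N, three_coef beta C)
             | C : 'I_beta.+2 <- index_enum 'I_beta.+2]
       ++ [seq (3%N :: nseq C 2%N ++ nseq (2 * (beta - C)) 1%N, twos_coef beta 0 C)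
             | C : 'I_beta.+1 <- index_enum 'I_beta.+1].
rewrite (@schur_coefE _ l).
- by rewrite big_cat !big_map.
- rewrite all_cat !all_map; apply/andP; split; apply/allP => C _.
    exact: is_part_twos_ones.
  exact: is_part_three_twos_ones.
- by move=> N; rewrite XK_three_twos_schur big_cat !big_map.
Qed.

Lemma twos_coef_ge0 a b C : 0 <= twos_coef a b C.
Proof. by rewrite mulr_ge0 ?ler0n ?fdiff_ge0. Qed.

Lemma three_coef_ge0 beta C : 0 <= three_coef beta C.
Proof.
(* [Nsp3] is defined by subtractions; it is nonnegative because it counts sequences. *)
case: C => [|C]; first by rewrite /three_coef -NspK_three_twos.
by rewrite /= !mulr_ge0 ?ler0n ?fdiff_ge0.
Qed.

Lemma NspK_twos m : (NspK (nseq m 2%N))%:Z = fdiff m m.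
Proof. by rewrite -[nseq m 2%N]cats0 (@NspK_twos_ones m 0) // addn0. Qed.

Lemma NspK_twos_one m : (NspK (nseq m 2%N ++ [:: 1%N]))%:Z = fdiff m m.+1.
Proof. by rewrite (@NspK_twos_ones m 1) // addn1. Qed.

Lemma ffact_div n m : (m <= n)%N ->
  (n ^_ m)%:R = (n`!)%:R / ((n - m)`!)%:R :> rat.
Proof.
move=> mn; rewrite -(ffact_fact mn) natrM mulfK //.
by rewrite pnatr_eq0 -lt0n fact_gt0.
Qed.

Lemma schur_coef_twosE beta C D : (2 * C + D = 2 * beta)%N ->
  schur_coef (XK (nseq beta 2%N)) (nseq C 2%N ++ nseq D 1%N) = twos_coef beta 0 C.
Proof.
move=> CD; have lt : (C < beta.+1)%N by lia.
rewrite schur_coef_twos (big_pred1 (Ordinal lt)) // => i.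
by rewrite twos_ones_eq /= -val_eqE /=; apply/andP/eqP;
  [case=> /eqP | move=> ->; split; apply/eqP; lia].
Qed.

Lemma schur_coef_three_twosE beta C D : (2 * C + D = 2 * beta)%N ->
  schur_coef (XK (3%N :: nseq beta 2%N)) (3%N :: nseq C 2%N ++ nseq D 1%N)
    = twos_coef beta 0 C.
Proof.
move=> CD; have lt : (C < beta.+1)%N by lia.
rewrite schur_coef_three_twos big_pred0 => [|i]; last first.
  by rewrite eq_sym three_neq_twos_ones.
rewrite add0r (big_pred1 (Ordinal lt)) // => i.
by rewrite eqseq_cons eqxx twos_ones_eq /= -val_eqE /=;
  apply/andP/eqP; [case=> /eqP|move=> ->; split; apply/eqP; lia].
Qed.

Lemma schur_coef_three_twos_twos beta C D : (2 * C + D = 2 * beta + 3)%N ->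
  schur_coef (XK (3%N :: nseq beta 2%N)) (nseq C 2%N ++ nseq D 1%N)
    = three_coef beta C.
Proof.
move=> CD; have lt : (C < beta.+2)%N by lia.
rewrite schur_coef_three_twos [X in _ + X]big_pred0 => [|i]; last first.
  exact: three_neq_twos_ones.
rewrite addr0 (big_pred1 (Ordinal lt)) // => i.
by rewrite twos_ones_eq /= -val_eqE /=; apply/andP/eqP;
  [case=> /eqP | move=> ->; split; apply/eqP; lia].
Qed.

Theorem theorem4p13 (beta : nat) (hbeta : (1 <= beta)%N) :
  schur_positive (XK (3%N :: nseq beta 2%N)) /\
  (forall C D : nat, (2 * C + D = 2 * beta)%N ->
     schur_coef (XK (3%N :: nseq beta 2%N)) (3%N :: nseq C 2%N ++ nseq D 1%N)
       = schur_coef (XK (nseq beta 2%N)) (nseq C 2%N ++ nseq D 1%N)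
     /\
     (schur_coef (XK (nseq beta 2%N)) (nseq C 2%N ++ nseq D 1%N))%:~R
       = (beta`!)%:R / ((beta - C)`!)%:R * (NspK (nseq (beta - C) 2%N))%:R :> rat) /\
  (forall C D : nat, (1 <= C)%N -> (1 <= D)%N -> (2 * C + D = 2 * beta + 3)%N ->
     (schur_coef (XK (3%N :: nseq beta 2%N)) (nseq C 2%N ++ nseq D 1%N))%:~R
       = (beta`!)%:R / ((beta + 1 - C)`!)%:R *
         ((beta + 1 - C)%:R
            * (if (beta < C)%N then 0 else (NspK (3%N :: nseq (beta - C) 2%N))%:R)
          - (NspK (nseq (beta + 1 - C) 2%N))%:R
          + (C + 2)%:R * (NspK (nseq (beta + 1 - C) 2%N ++ [:: 1%N]))%:R) :> rat) /\
  schur_coef (XK (3%N :: nseq beta 2%N)) (nseq (2 * beta + 3) 1%N)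
    = (NspK (3%N :: nseq beta 2%N))%:R.
Proof.
split.
  move=> mu _; rewrite schur_coef_three_twos addr_ge0 // sumr_ge0 // => C _.
    exact: three_coef_ge0.
  exact: twos_coef_ge0.
split.
  move=> C D CD; rewrite schur_coef_three_twosE // schur_coef_twosE //; split=> //.
  have Cb : (C <= beta)%N by lia.
  by rewrite /twos_coef addn0 intrM -NspK_twos rmorph_nat ffact_div // -pmulrn.
split; last first.
  rewrite -[nseq _ 1%N]/(nseq 0 2%N ++ nseq (2 * beta + 3) 1%N).
  by rewrite schur_coef_three_twos_twos // /three_coef -NspK_three_twos natz.
move=> [//|C] D _ _ CD; rewrite schur_coef_three_twos_twos //.
have Cb : (C <= beta)%N by lia.
rewrite addn1 subSS /three_coef !intrM !rmorph_nat ffact_div // -!mulrA; congr (_ * (_ * _)).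
rewrite !pmulrn NspK_twos NspK_twos_one -!pmulrn ltnS leqNgt.
case: (ltnP C beta) => [ltCb|]; last first.
  (* Here the number of twos is beta + 1, both remaining Nsp values are 1, and the bracket is -1 +
     (beta + 3). *)
  move=> bC; have -> : C = beta by apply/eqP; rewrite eqn_leq Cb.
  rewrite subnn -addn2 -addSnnS mul0r sub0r !natrD.
  by rewrite /fdiff /=; ring.
rewrite [(NspK (3%N :: _))%:R]pmulrn NspK_three_twos.
have -> : (beta - C = (beta - C.+1).+1)%N by lia.
(* By [Nsp3E] the first product contains the subtracted Nsp value once, which cancels; the multiples
   of the last Nsp value add up to beta + 2. *)
rewrite -[X in _ = X * _ - _ + _](rmorph_nat (intmul 1)) -intrM Nsp3E intrD intrM rmorph_nat.
have -> : beta.+2 = (beta - C.+1 + (C.+1 + 2))%N by lia.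
by rewrite natrD; ring.
Qed.
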